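(* Let $d\ge 2$ and let $\sigma$ be an admissible probability measure on $\mathbb{R}^d$. Then there are functions $g(\varepsilon)>0$ and $h(\varepsilon,\delta)$ (for $\varepsilon,\delta>0$), with $h(\varepsilon,\delta)\to 0$ as $\delta\to 0$ for every fixed $\varepsilon>0$, such that for all $R>0$, $\varepsilon>0$, $\delta>0$ and every measurable $A\subset Q(0,R)$, $$I_\sigma(A)\geq g(\varepsilon)\, I_\sigma\bigl(\mathcal{Z}_\delta(\varepsilon)A\bigr)-h(\varepsilon,\delta)R^d.$$
   Context: $Q(x,r)$ is the open axis-parallel cube in $\mathbb{R}^d$ of side length $r$ centered at $x$; $|\cdot|$ is Lebesgue measure; sets are identified with their characteristic functions. A Borel probability measure $\sigma$ on $\mathbb{R}^d$ is admissible if it is symmetric around $0$, has compact support, $0\notin\operatorname{supp}\sigma$, and $\hat\sigma(\xi)=\int e^{-2\pi i\langle x,\xi\rangle}\,d\sigma(x)\to 0$ as $|\xi|\to\infty$. For measurable $A$, $I_\sigma(A)=\iint A(x)A(x+y)\,d\sigma(y)\,dx$. The zooming-out operator is $\mathcal{Z}_\delta(\varepsilon)A=\{x\in\mathbb{R}^d : |Q(x,\delta)\cap A|>\varepsilon|Q(x,\delta)|\}$. *)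

(* Defs.v *)
(* The points of R^d are the row vectors 'rV[R]_d. *)
From HB Require Import structures.
From mathcomp Require Import all_boot all_order all_algebra.
From mathcomp Require Import complex.
From mathcomp Require Import all_classical all_reals all_analysis measurable_realfun.

Set Implicit Arguments.
Unset Strict Implicit.
Unset Printing Implicit Defensive.

Import Order.TTheory GRing.Theory Num.Theory.
Import numFieldNormedType.Exports.

Local Open Scope classical_set_scope.
Local Open Scope ring_scope.

(* [measurable] on matrices, hence on 'rV[R]_d, is the Borel sigma-algebra of
   the topology that the library puts on them. *)
HB.instance Definition _ (R : realType) (m n : nat) :=
  @isMeasurable.Build (sigma_display (@open 'M[R]_(m, n))) 'M[R]_(m, n)
    <<s @open 'M[R]_(m, n) >> (@sigma_algebra0 _ setT _)
    (@sigma_algebraC _ _) (@sigma_algebra_bigcup _ setT _).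

Section rV_measurable.
Variable R : realType.

Lemma measurable_rV_coord n (i : 'I_n) :
  measurable_fun [set: 'rV[R]_n] (fun x => x 0 i).
Proof.
apply: (measurability _ (RGenOpens.measurableE R)).
move=> _ [_ [a [b ->] <-]]; rewrite setTI; apply: sub_sigma_algebra.
apply: open_comp => [x _|]; first exact: coord_continuous.
exact: interval_open.
Qed.

Lemma measurable_fun_rV d (T : measurableType d) n (f : T -> 'rV[R]_n) :
  (forall i, measurable_fun setT (fun t => f t 0 i)) -> measurable_fun setT f.
Proof.
move=> mf; apply: (measurability (@open 'rV[R]_n)) => // _ [U oU <-].
rewrite setTI.
pose c (q : 'rV[rat]_n) : 'rV[R]_n := map_mx ratr q.
pose P (p : 'rV[rat]_n * nat) := ball (c p.1) p.2.+1%:R^-1 `<=` U.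
pose B (p : 'rV[rat]_n * nat) :=
  [set t | P p /\ forall i, ball (c p.1 0 i) (p.2.+1%:R^-1 : R) (f t 0 i)].
have -> : f @^-1` U = \bigcup_p B p.
  rewrite predeqE => t; split => [Uft|[[q k] _ [+ ftq]]]; last first.
    by apply; split; [rewrite invr_gt0|move=> i j; rewrite !ord1; exact: ftq].
  have /nbhs_ballP[e /= e0 eU] : nbhs (f t) U by exact: open_nbhs_nbhs.
  have e20 : 0 < e / 2 by rewrite divr_gt0.
  have [k ke] : exists k, k.+1%:R^-1 < e / 2.
    by have [k] := ltr_add_invr e20; rewrite add0r => ?; exists k.
  have k0 : 0 < k.+1%:R^-1 :> R by rewrite invr_gt0.
  have /choice[q qP] : forall i : 'I_n, exists q : rat,
      `|ratr q - f t 0 i| < k.+1%:R^-1.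
    move=> i; have : f t 0 i - k.+1%:R^-1 < f t 0 i + k.+1%:R^-1.
      by rewrite ltrBlDr -addrA ltrDl addr_gt0.
    by move=> /rat_in_itvoo[q]; rewrite in_itv/= -ltr_distl => ?; exists q.
  exists (\row_i q i, k) => //; split => [y [_ yc]|i] /=; last first.
    by rewrite !mxE; exact: qP.
  apply: eU; split => // i j; rewrite ord1 (splitr e).
  apply: (@ball_triangle _ _ (ratr (q j) : R)).
    by rewrite /ball/= distrC (lt_trans (qP j)).
  have := yc 0 j; rewrite /= !mxE /ball /= => yq.
  exact: lt_trans ke.
apply: countable_bigcupT_measurable => // -[q k].
rewrite /B; have [Pqk|nP] := pselect (P (q, k)); last first.
  by rewrite (_ : mkset _ = set0) // predeqE => t; split => // -[].
rewrite (_ : mkset _ = \bigcap_(i in [set: 'I_n])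
    ((fun t => f t 0 i) @^-1` ball (c q 0 i) (k.+1%:R^-1 : R))).
  apply: fin_bigcap_measurable => // i _; rewrite -[X in measurable X]setTI.
  by apply: mf => //; apply: open_measurable; exact: ball_open.
by rewrite predeqE => t; split => [[_ ht] i _|ht]; [exact: ht|split => // i; exact: ht].
Qed.

Definition cons_rV n (p : R * 'rV[R]_n) : 'rV[R]_n.+1 :=
  row_mx (const_mx p.1 : 'rV_1) p.2.

Lemma measurable_cons_rV n : measurable_fun setT (@cons_rV n).
Proof.
apply: measurable_fun_rV => i; have [j ->|j ->] := @split_ordP 1 n i.
  rewrite (_ : (fun t => _) = fst); first exact: measurable_fst.
  by apply/funext => p; rewrite /cons_rV (@row_mxEl R 1 1 n) mxE.
rewrite (_ : (fun t => _) = (fun x : 'rV[R]_n => x 0 j) \o snd).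
  apply: measurableT_comp; [exact: measurable_rV_coord|exact: measurable_snd].
by apply/funext => p; rewrite /cons_rV (@row_mxEr R 1 1 n).
Qed.

Lemma measurable_behead_rV n :
  measurable_fun setT (fun x : 'rV[R]_n.+1 => (x 0 0, rsubmx (x : 'rV_(1 + n)))).
Proof.
apply/measurable_fun_pairP; split; first exact: measurable_rV_coord.
apply: measurable_fun_rV => i; rewrite (_ : (fun t => _) =
    (fun x : 'rV[R]_n.+1 => x 0 (rshift 1 i))); first exact: measurable_rV_coord.
by apply/funext => x /=; rewrite mxE.
Qed.

Lemma cons_rVK n (p : R * 'rV[R]_n) :
  (cons_rV p 0 0, rsubmx (cons_rV p : 'rV_(1 + n))) = p.
Proof.
case: p => a x; congr (_, _); last exact: row_mxKr.
have -> : 0 = lshift n 0 :> 'I_(1 + n) by exact: val_inj.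
by rewrite /cons_rV (@row_mxEl R 1 1 n) mxE.
Qed.

End rV_measurable.

Lemma sigma_finite_product d1 d2 (T1 : measurableType d1)
    (T2 : measurableType d2) (R : realType)
    (m1 : {sigma_finite_measure set T1 -> \bar R})
    (m2 : {sigma_finite_measure set T2 -> \bar R}) :
  sigma_finite setT (m1 \x m2)%E.
Proof.
have /sigma_finiteP[F [TF ndF Foo]] := sigma_finiteT m1.
have /sigma_finiteP[G [TG ndG Goo]] := sigma_finiteT m2.
exists (fun n => F n `*` G n).
  rewrite -setXTT TF TG predeqE => -[x y]; split.
    move=> [/= [n _ Fnx] [k _ Gky]]; exists (maxn n k) => //; split.
    - by move: x Fnx; exact/subsetPset/ndF/leq_maxl.
    - by move: y Gky; exact/subsetPset/ndG/leq_maxr.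
  by move=> [n _ []/= ? ?]; split; exists n.
move=> k; have [? ?] := Foo k; have [? ?] := Goo k.
split; first exact: measurableX.
by rewrite product_measure1E// lte_mul_pinfty// ge0_fin_numE.
Qed.

Lemma sigma_finite_measureP d (T : measurableType d) (R : realType)
    (m : set T -> \bar R) :
  m set0 = 0%E -> (forall A, (0 <= m A)%E) -> semi_sigma_additive m ->
  sigma_finite setT m ->
  exists mu : {sigma_finite_measure set T -> \bar R}, m = mu.
Proof.
move=> m0 mge0 madd msf.
pose mm := isMeasure.Build _ _ _ m m0 mge0 madd.
pose M : {measure set T -> \bar R} := HB.pack m mm.
pose ms := Measure_isSigmaFinite.Build _ _ _ M msf.
pose S : {sigma_finite_measure set T -> \bar R} := HB.pack m mm ms.
by exists S.
Qed.

Section rV_lebesgue.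
Variable R : realType.
Local Open Scope ereal_scope.

(* Lebesgue measure on the Borel sets of R^n: the n-fold product of the
   one-dimensional Lebesgue measure. *)
Fixpoint rV_lebesgue n : set 'rV[R]_n -> \bar R :=
  if n is m.+1
  then pushforward (@lebesgue_measure R \x @rV_lebesgue m) (@cons_rV R m)
  else \d_(0%R : 'rV[R]_0).

Let rV_lebesgueP n :
  exists mu : {sigma_finite_measure set 'rV[R]_n -> \bar R},
    @rV_lebesgue n = mu.
Proof.
elim: n => [|n [mu muE]]; first by exists (\d_(0%R : 'rV[R]_0)).
rewrite /= muE; set nu := (X in pushforward X _); set f := (X in pushforward _ X).
have mf : measurable_fun setT f := @measurable_cons_rV R n.
pose nu' : {measure set (measurableTypeR R * 'rV[R]_n)%type -> \bar R} :=
  (@lebesgue_measure R \x mu).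
have p0 : pushforward nu f set0 = 0.
  by rewrite /pushforward preimage_set0; exact: (measure0 nu').
have pge0 A : 0 <= pushforward nu f A by exact: (measure_ge0 nu').
have padd : semi_sigma_additive (pushforward nu f).
  exact: (@measure_semi_sigma_additive _ _ _ (pushforward nu' f)).
have psf : sigma_finite setT (pushforward nu f).
  have [F FT Foo] := sigma_finite_product (@lebesgue_measure R) mu.
  pose g (x : 'rV[R]_n.+1) := (x 0%R 0%R, rsubmx (x : 'rV_(1 + n))).
  exists (fun k => g @^-1` F k); first by rewrite -preimage_bigcup -FT preimage_setT.
  move=> k; have [mF Fk] := Foo k; split.
    by rewrite -[X in measurable X]setTI; exact: measurable_behead_rV.
  rewrite /pushforward (_ : _ @^-1` _ = F k) //.
  by apply/seteqP; split => p; rewrite /= /g cons_rVK.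
exact: sigma_finite_measureP.
Qed.

Variable n : nat.

Let rV_lebesgue0 : @rV_lebesgue n set0 = 0.
Proof. by have [mu ->] := rV_lebesgueP n; exact: measure0. Qed.

Let rV_lebesgue_ge0 A : 0 <= @rV_lebesgue n A.
Proof. by have [mu ->] := rV_lebesgueP n; exact: measure_ge0. Qed.

Let rV_lebesgue_sigma_additive : semi_sigma_additive (@rV_lebesgue n).
Proof.
by have [mu ->] := rV_lebesgueP n; exact: measure_semi_sigma_additive.
Qed.

HB.instance Definition _ := isMeasure.Build _ _ _ (@rV_lebesgue n)
  rV_lebesgue0 rV_lebesgue_ge0 rV_lebesgue_sigma_additive.

Let rV_lebesgue_sigma_finite : sigma_finite setT (@rV_lebesgue n).
Proof. by have [mu ->] := rV_lebesgueP n; exact: sigma_finiteT. Qed.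

HB.instance Definition _ := Measure_isSigmaFinite.Build _ _ _ (@rV_lebesgue n)
  rV_lebesgue_sigma_finite.

End rV_lebesgue.
Arguments rV_lebesgue {R n}.

Section completed_rV_lebesgue.
Variables (R : realType) (n : nat).

(* The domain carries the Caratheodory sigma-algebra of the outer measure of
   rV_lebesgue; by sigma-finiteness, this is the completion of the Borel one. *)
Definition completed_rV_lebesgue :=
  @completed_measure_extension _ _ _ (@rV_lebesgue R n).

HB.instance Definition _ := Measure.on completed_rV_lebesgue.

HB.instance Definition _ := Measure_isSigmaFinite.Build _ _ _
  completed_rV_lebesgue
  (completed_measure_extension_sigma_finite
    (sigma_finiteT (@rV_lebesgue R n))).

Definition lebesgue_measurable : set (set 'rV[R]_n) :=
  ((@rV_lebesgue R n)^*)%mu.-cara.-measurable.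

End completed_rV_lebesgue.
Arguments completed_rV_lebesgue {R n}.

Section zooming_out.
Variables (R : realType) (d : nat).
Implicit Types (x y xi : 'rV[R]_d) (A B U : set 'rV[R]_d).
Implicit Type sigma : probability 'rV[R]_d R.

Definition dotrv x y : R := \sum_(i < d) x 0 i * y 0 i.

(* The library norm on 'rV[R]_d is the sup norm. *)
Definition enorm x : R := Num.sqrt (dotrv x x).

Definition cube x (r : R) : set 'rV[R]_d :=
  [set y | forall i, `|y 0 i - x 0 i| < r / 2].

Definition msupport sigma : set 'rV[R]_d :=
  [set x | forall U, open U -> U x -> (0 < sigma U)%E].

(* e ^ (- 2 pi i <x, xi>) = cos (- 2 pi <x, xi>) + i sin (- 2 pi <x, xi>). *)
Definition fourier sigma xi : R[i] :=
  Complex (\int[sigma]_x cos (- (2 * pi * dotrv x xi)))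
          (\int[sigma]_x sin (- (2 * pi * dotrv x xi))).

Definition admissible sigma : Prop :=
  [/\ forall B, measurable B -> sigma [set x | B (- x)] = sigma B,
      compact (msupport sigma),
      ~ msupport sigma 0
    & forall e : R, 0 < e -> exists M : R, forall xi,
        M < enorm xi -> Normc.normc (fourier sigma xi) < e].

(* For a Lebesgue measurable A and almost every x, the function of y below
   agrees with a Borel function outside a sigma-null set, and the inner integral
   is then the integral of that function; the outer integral is with respect to
   the completed measure, so the exceptional x do not matter. *)
Definition Isigma sigma A : \bar R :=
  (\int[completed_rV_lebesgue]_x \int[sigma]_y
     (\1_A (x : 'rV[R]_d) * \1_A ((x : 'rV[R]_d) + y))%:E)%E.

Definition zoom_out (delta eps : R) A : set 'rV[R]_d :=
  [set x | (eps%:E * completed_rV_lebesgue (cube x delta)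
              < completed_rV_lebesgue (cube x delta `&` A))%E].

End zooming_out.

(* Main.v *)
Require Import Defs.
From HB Require Import structures.
From mathcomp Require Import all_boot all_order all_algebra.
From mathcomp Require Import complex.
From mathcomp Require Import all_classical all_reals all_analysis measurable_realfun.
From mathcomp Require Import ring lra.

Set Implicit Arguments.
Unset Strict Implicit.
Unset Printing Implicit Defensive.

Import Order.TTheory GRing.Theory Num.Theory.
Import numFieldNormedType.Exports.

Local Open Scope classical_set_scope.
Local Open Scope ring_scope.

(** Write [G] for the autocorrelation of a bounded Borel set [B], so that
    [G u] is the measure of the points [x] with [x] and [x + u] both in [B]. Then
    [Isigma sigma B] is the [sigma]-mean of [G], and [G] is a continuous positive
    definite function: it is a superposition of cosines with the nonnegative
    weights [|B^(xi)|^2]. Against the symmetric measure [sigma], the cosine of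
    frequency [xi] has mean [sigma^(xi)], and a shift of [sigma] by [w] multiplies
    this mean by [cos (2 pi <w, xi>)]. Therefore the shift changes the mean of [G]
    by at most [G 0] times the supremum over [xi] of
    [|sigma^(xi)| (1 - cos (2 pi <w, xi>))] ([mean_autocorr_shift]). This supremum
    tends to zero with [w], because [sigma^] is small at high frequencies and the
    phase is small at low ones ([oscillation_cvg0]).

    The zooming-out inequality follows by averaging over the shifts [w = v - u]
    with [u] and [v] in the cube [Q(0, delta)]. The averaged mean is the
    correlation along [sigma] of the convolution of [B] with that cube, and this
    convolution is, by definition, at least [eps |Q|] on the zoomed-out set.
    Hence [g eps = eps ^+ 2] works, with an error term that depends on [delta]
    only ([zoom_out_correlation]).

    The superposition of cosines is obtained without Fourier inversion on the
    whole space. The set [B] is placed in a large torus and [G] is averaged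
    against the Fejer kernel of the torus. By the expansion of the kernel, this
    average is a finite sum of cosines with nonnegative coefficients
    ([fejer_mean_double_integral]), and it converges to [G] uniformly on cubes
    ([fejer_mean_approx]), since [G] is uniformly continuous. The continuity comes
    from the continuity in measure of translations, which holds for half-spaces
    and propagates to the sigma-algebra that they generate
    ([measurable_translation_continuous]).

    A Lebesgue measurable set contains a Borel set of the same measure, with the
    same zoomed-out set and no larger correlation, so Borel sets suffice
    ([inner_kernel], [zoom_out_borel], [le_Isigma]). *)

(** * Lebesgue measure on row vectors *)

Section rV_lebesgue_theory.
Variable R : realType.
Local Open Scope ereal_scope.

(** The measure in dimension [n.+1] is a pushforward of a product measure, so
    Tonelli peels off the first coordinate; translation invariance and the
    integrals of product functions follow by induction on the dimension. *)
Lemma ge0_integral_rVS n (f : 'rV[R]_n.+1 -> \bar R) :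
  measurable_fun setT f -> (forall x, 0 <= f x) ->
  \int[rV_lebesgue]_x f x =
  \int[lebesgue_measure]_a \int[rV_lebesgue]_x f (cons_rV (a, x)).
Proof.
move=> mf f0.
have mc := @measurable_cons_rV R n.
transitivity (\int[pushforward (@lebesgue_measure R \x @rV_lebesgue R n) (@cons_rV R n)]_x f x).
  exact: eq_measure_integral.
rewrite ge0_integral_pushforward// preimage_setT.
apply: (@fubini_tonelli1 _ _ (measurableTypeR R) _ _ lebesgue_measure rV_lebesgue
  (f \o @cons_rV R n)).
  exact: (measurableT_comp mf mc).
by move=> p; exact: f0.
Qed.

(** Lebesgue measure is determined by its values on half-open intervals. *)
Lemma lebesgue_measureD (a : R) (A : set R) : measurable A ->
  pushforward (@lebesgue_measure R) (fun x : R => x + a : measurableTypeR R)%R A =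
  lebesgue_measure A.
Proof.
have mD : measurable_fun setT (fun x : R => x + a : measurableTypeR R)%R.
  exact: measurable_funD.
move=> mA; apply/esym/lebesgue_measure_unique => //= _ [[b c]] _ <-.
rewrite /pushforward (_ : _ @^-1` _ = `]b - a, c - a]%classic)%R; last first.
  by apply/seteqP; split => x /=; rewrite !in_itv/= ltrBlDr lerBrDr.
rewrite !lebesgue_measure_itv/= !lte_fin ltrD2r.
by case: ifPn => // _; rewrite -!EFinB; congr EFin; ring.
Qed.

Lemma ge0_integral_lebesgueD (a : R) (f : R -> \bar R) :
  measurable_fun setT f -> (forall x, 0 <= f x) ->
  \int[lebesgue_measure]_x f (x + a)%R = \int[lebesgue_measure]_x f x.
Proof.
move=> mf f0.
have mD : @measurable_fun _ _ (measurableTypeR R) (measurableTypeR R) setT (fun x => x + a)%R.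
  exact: measurable_funD.
have := ge0_integral_pushforward mD lebesgue_measure measurableT mf (fun x _ => f0 x).
rewrite preimage_setT => /esym E; apply: (etrans E).
by apply: eq_measure_integral => A mA _; exact: lebesgue_measureD.
Qed.

Lemma measurable_rVD d (T : measurableType d) n (f g : T -> 'rV[R]_n) :
  measurable_fun setT f -> measurable_fun setT g ->
  measurable_fun setT (fun t => f t + g t)%R.
Proof.
move=> mf mg; apply: measurable_fun_rV => i.
rewrite (_ : (fun t => _) = (fun t => f t 0 i + g t 0 i)%R); last first.
  by apply/funext => t; rewrite mxE.
by apply: measurable_funD; apply: (measurableT_comp (measurable_rV_coord i)).
Qed.

Lemma measurable_rVN d (T : measurableType d) n (f : T -> 'rV[R]_n) :
  measurable_fun setT f ->  measurable_fun setT (fun t => - f t)%R.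
Proof.
move=> mf; apply: measurable_fun_rV => i.
rewrite (_ : (fun t => _) = (fun t => - f t 0 i)%R); last first.
  by apply/funext => t; rewrite mxE.
by apply: measurable_funN; apply: (measurableT_comp (measurable_rV_coord i)).
Qed.

Lemma cons_rV0 n (p : R * 'rV[R]_n) : cons_rV p 0%R ord0 = p.1.
Proof. by have [] := cons_rVK p; case: p => a x [-> _]. Qed.

Lemma cons_rVS n (p : R * 'rV[R]_n) j : cons_rV p 0%R (lift ord0 j) = p.2 0%R j.
Proof.
case: p => a x; have [_ /rowP/(_ j)] := cons_rVK (a, x).
by rewrite mxE => /= <-; congr (cons_rV _ _ _); exact: val_inj.
Qed.

Lemma cons_rV_eta n (x : 'rV[R]_n.+1) :
  x = cons_rV (x 0%R ord0, \row_j x 0%R (lift ord0 j)).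
Proof.
apply/rowP => i; case: (unliftP ord0 i) => [j|] ->.
  by rewrite !cons_rVS mxE.
by rewrite !cons_rV0.
Qed.

Lemma cons_rVD n a b (x y : 'rV[R]_n) :
  (cons_rV (a, x) + cons_rV (b, y) = cons_rV (a + b, x + y))%R.
Proof.
apply/rowP => i; rewrite mxE; case: (unliftP ord0 i) => [j|] ->.
  by rewrite !cons_rVS mxE.
by rewrite !cons_rV0.
Qed.

Lemma ge0_integral_rVD n (a : 'rV[R]_n) (f : 'rV[R]_n -> \bar R) :
  measurable_fun setT f -> (forall x, 0 <= f x) ->
  \int[rV_lebesgue]_x f (x + a)%R = \int[rV_lebesgue]_x f x.
Proof.
elim: n => [|n IHn] in a f * => mf f0.
  by apply: eq_integral => x _; congr f; rewrite [LHS]thinmx0 [RHS]thinmx0.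
rewrite (cons_rV_eta a); move: (a _ _) (\row__ _) => {a} b c /=.
have mD : measurable_fun setT (fun x : 'rV[R]_n.+1 => x + cons_rV (b, c))%R.
  exact: measurable_rVD.
rewrite !ge0_integral_rVS//; last exact: measurableT_comp.
have mS (t : R) : measurable_fun setT (fun x : 'rV[R]_n => f (cons_rV (t, x))).
  apply: (measurableT_comp mf); apply: (measurableT_comp (@measurable_cons_rV R n)).
  exact: measurable_pair1.
transitivity (\int[lebesgue_measure]_t \int[rV_lebesgue]_x f (cons_rV (t + b, x)%R)).
  apply: eq_integral => t _.
  under eq_integral do rewrite cons_rVD.
  exact: (IHn c (fun x => f (cons_rV ((t + b)%R, x)))).
apply: (ge0_integral_lebesgueD b (f := fun t => \int[rV_lebesgue]_x f (cons_rV (t, x)))).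
  apply: (@measurable_fun_fubini_tonelli_F _ _ (measurableTypeR R) _ _ rV_lebesgue
    (f \o @cons_rV R n)); last by move=> p; exact: f0.
  exact: (measurableT_comp mf (@measurable_cons_rV R n)).
by move=> t; exact: integral_ge0.
Qed.

Lemma measurable_cube n (c : 'rV[R]_n) (r : R) : measurable (cube c r).
Proof.
rewrite (_ : cube c r = \bigcap_(i in [set: 'I_n])
    ((fun x : 'rV[R]_n => x 0 i) @^-1` ball (c 0 i) (r / 2))%R); last first.
  by apply/seteqP; split => x cx i; [move=> _|]; rewrite /ball/= distrC;
     [exact: cx|have := cx i I; rewrite /ball/= distrC].
apply: fin_bigcap_measurable => // i _; rewrite -[X in measurable X]setTI.
by apply: measurable_rV_coord => //; exact: measurable_ball.
Qed.

Lemma ge0_integral_rV_prod n (F : 'I_n -> R -> R) (a : 'I_n -> R) :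
  (forall i, measurable_fun setT (F i)) -> (forall i t, 0 <= F i t)%R ->
  (forall i, \int[lebesgue_measure]_t (F i t)%:E = (a i)%:E) ->
  \int[rV_lebesgue]_x (\prod_(i < n) F i (x 0 i))%:E = (\prod_(i < n) a i)%:E.
Proof.
elim: n => [|n IHn] in F a * => mF F0 Fa.
  rewrite big_ord0; under eq_integral do rewrite big_ord0.
  by rewrite integral_cst//= diracT mule1.
have mP m (G : 'I_m -> R -> R) : (forall i, measurable_fun setT (G i)) ->
    measurable_fun setT (fun x : 'rV[R]_m => (\prod_(i < m) G i (x 0 i))%:E)%R.
  move=> mG; apply/measurable_EFinP; apply: measurable_prod => i _.
  exact: (measurableT_comp (mG i) (measurable_rV_coord i)).
rewrite ge0_integral_rVS//; last 2 first.
- exact: mP.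
- by move=> x; rewrite lee_fin prodr_ge0.
rewrite big_ord_recl EFinM -Fa -ge0_integralZr//; last 3 first.
- by apply/measurable_EFinP; exact: (mF ord0).
- by move=> t _; rewrite lee_fin.
- rewrite lee_fin prodr_ge0// => i _; rewrite -lee_fin -Fa integral_ge0// => t _.
  by rewrite lee_fin.
apply: eq_integral => t _.
rewrite -(IHn (fun i => F (lift ord0 i)) (fun i => a (lift ord0 i)))//.
rewrite -ge0_integralZl//; last 3 first.
- exact: (mP _ (fun i => F (lift ord0 i))).
- by move=> x _; rewrite lee_fin prodr_ge0.
- by rewrite lee_fin.
apply: eq_integral => x _; rewrite -EFinM big_ord_recl cons_rV0/=.
by under eq_bigr do rewrite cons_rVS.
Qed.

Lemma ge0_integral_cube_prod n (c : 'rV[R]_n) (r : R) (F : 'I_n -> R -> R) (a : 'I_n -> R) :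
  (forall i, measurable_fun setT (F i)) -> (forall i t, 0 <= F i t)%R ->
  (forall i, \int[lebesgue_measure]_(t in ball (c 0 i)%R (r / 2)%R) (F i t)%:E = (a i)%:E) ->
  \int[rV_lebesgue]_(x in cube c r) (\prod_(i < n) F i (x 0 i))%:E
  = (\prod_(i < n) a i)%:E.
Proof.
move=> mF F0 Fa; rewrite integral_mkcond.
rewrite -(@ge0_integral_rV_prod _
  (fun i t => F i t * \1_(ball (c 0 i) (r / 2)) t) a)%R; last 3 first.
- by move=> i; apply: measurable_funM => //; apply: measurable_indic; exact: measurable_ball.
- by move=> i t; rewrite mulr_ge0.
- move=> i; rewrite -Fa [RHS]integral_mkcond; apply: eq_integral => t _.
  by rewrite patchE indicE; case: ifPn => _; rewrite ?mulr1 ?mulr0.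
apply: eq_integral => x _; rewrite big_split/= patchE.
case: ifPn => [/set_mem cx|/negP cx].
  rewrite [X in (_ * X)%R]big1 ?mulr1// => i _.
  by rewrite indicE mem_set// /ball/= distrC; exact: cx.
have [i ci] : exists i, ~ (`|x 0 i - c 0 i| < r / 2)%R.
  by apply/existsNP => cx'; apply: cx; exact: mem_set.
rewrite [X in (_ * X)%R](bigD1 i)//= indicE memNset ?mul0r ?mulr0//.
by rewrite /ball/= distrC.
Qed.

Lemma rV_lebesgue_cube n (c : 'rV[R]_n) (r : R) : (0 <= r)%R ->
  rV_lebesgue (cube c r) = (r ^+ n)%:E.
Proof.
move=> r0; rewrite -[LHS]mul1e -integral_cst; last exact: measurable_cube.
have -> : (r ^+ n = \prod_(i < n) r)%R by rewrite prodr_const card_ord.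
rewrite -(@ge0_integral_cube_prod _ c r (fun _ _ => 1%R))//.
  by apply: eq_integral => x _; rewrite big1.
move=> i; rewrite integral_cst//; last exact: measurable_ball.
rewrite mul1e; apply: etrans (lebesgue_measure_ball _ _) _; first exact: divr_ge0.
by rewrite mulr2n -splitr.
Qed.

Lemma measurable_indic_comp d (T : measurableType d) n (A : set 'rV[R]_n) (f : T -> 'rV[R]_n) :
  measurable A -> measurable_fun setT f -> measurable_fun setT (fun t => \1_A (f t) : R).
Proof. by move=> mA mf; apply: measurableT_comp mf; exact: measurable_indic. Qed.

Lemma measurable_shift n (B : set 'rV[R]_n) (u : 'rV[R]_n) :
  measurable B -> measurable [set x | B (x + u)%R].
Proof.
move=> mB.
have mD : measurable_fun setT (fun x : 'rV[R]_n => x + u)%R by exact: measurable_rVD.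
by rewrite -[X in measurable X]setTI; exact: mD.
Qed.

Lemma rV_lebesgueD n (a : 'rV[R]_n) (B : set 'rV[R]_n) : measurable B ->
  rV_lebesgue [set x | B (x + a)%R] = rV_lebesgue B.
Proof.
move=> mB.
have E C : measurable C -> \int[@rV_lebesgue R n]_x (\1_C x)%:E = rV_lebesgue C.
  by move=> mC; rewrite integral_indic// setIT.
rewrite -!E//; last exact: measurable_shift.
apply: (ge0_integral_rVD a (f := fun x => (\1_B x)%:E)) => [|x]; last by rewrite lee_fin.
by apply/measurable_EFinP; exact: measurable_indic.
Qed.

End rV_lebesgue_theory.

(** * Continuity in measure of translations *)

(** Continuity from above at the empty set, in the form of an approximation. *)
Lemma exists_small_measure d (T : measurableType d) (R : realType)
    (mu : {measure set T -> \bar R}) (F : (set T)^nat) (e : R) :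
  (mu (F 0%N) < +oo)%E -> (forall n, measurable (F n)) ->
  {homo F : n m / (n <= m)%N >-> (m <= n)%O} -> \bigcap_n F n = set0 ->
  0 < e -> exists n, (mu (F n) <= e%:E)%E.
Proof.
move=> F0 mF ndF capF e0.
have mcap : measurable (\bigcap_n F n) by rewrite capF.
have := nonincreasing_cvg_mu F0 mF mcap ndF; rewrite capF measure0 => mu0.
have : nbhs (0%E : \bar R) [set y | (y < e%:E)%E].
  by apply: open_nbhs_nbhs; split; [exact: open_ereal_lt_ereal|rewrite /= lte_fin].
move=> /mu0; rewrite /nbhs/= => -[N _ /(_ N (leqnn N))] /= /ltW.
by exists N.
Qed.

Section translation_continuity.
Variables (R : realType) (n : nat).
Implicit Types (B C : set 'rV[R]_n) (u : 'rV[R]_n).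
Let mu := @rV_lebesgue R n.

Definition leaving B u : set 'rV[R]_n := B `\` [set x | B (x + u)].

(** The truncation to a cube makes the condition meaningful for sets of infinite
    measure, so that these sets can form a sigma-algebra. *)
Definition translation_continuous : set (set 'rV[R]_n) :=
  [set B | measurable B /\ forall r e : R, 0 < e -> exists2 s : R, 0 < s &
     forall u, (forall i, `|u 0 i| < s) -> (mu (cube 0 r `&` leaving B u) <= e%:E)%E].

Lemma measurable_leaving B u : measurable B -> measurable (leaving B u).
Proof. by move=> mB; apply: measurableD => //; exact: measurable_shift. Qed.

Lemma cube0 (r : R) : cube (0 : 'rV[R]_n) r = [set x | forall i, `|x 0 i| < r / 2].
Proof. by apply/seteqP; split => x xr i; have := xr i; rewrite /= !mxE subr0. Qed.

Let mcube (r : R) : measurable (cube (0 : 'rV[R]_n) r).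
Proof. exact: measurable_cube. Qed.

Let finite_cube (r : R) C : measurable C -> (mu (cube 0 r `&` C) < +oo)%E.
Proof.
move=> mC; apply: (@le_lt_trans _ _ (mu (cube 0 `|r|))).
  apply: le_measure; rewrite ?inE//; first exact: measurableI.
  move=> x [+ _]; rewrite !cube0 => + i => /(_ i) /= /lt_le_trans; apply.
  by rewrite ler_pM2r// ler_norm.
by rewrite [X in (X < _)%E]rV_lebesgue_cube ?ltry.
Qed.

(** A point that leaves the complement of [B] under the shift by [u] is the
    image by [- u] of a point leaving [B] under the shift by [- u]: translation
    invariance reduces the complement to [B], at the price of a cube enlarged by
    the size of the shift. *)
Lemma translation_continuousC B :
  translation_continuous B -> translation_continuous (~` B).
Proof.
move=> [mB tcB]; split => [|r e e0]; first exact: measurableC.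
have [s s0 sB] := tcB (r + 2) e e0.
exists (Num.min s 1) => [|u us]; first by rewrite lt_min s0/=.
apply: le_trans (sB (- u) _); last first.
  by move=> i; rewrite mxE normrN; have := us i; rewrite lt_min => /andP[].
rewrite -[leRHS](rV_lebesgueD u); last by apply: measurableI => //; exact: measurable_leaving.
apply: le_measure; rewrite ?inE.
- by apply: measurableI => //; apply: measurable_leaving; exact: measurableC.
- by apply: measurable_shift; apply: measurableI => //; exact: measurable_leaving.
move=> x [+ [nBx /contrapT Bxu]]; rewrite !cube0 => xr; split => /=.
  move=> i; rewrite mxE; have := us i; rewrite lt_min => /andP[_ u1].
  by have := ler_normD (x 0 i) (u 0 i); have := xr i => /=; lra.
by split => //=; rewrite addrK.
Qed.

Lemma translation_continuousU B C : translation_continuous B ->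
  translation_continuous C -> translation_continuous (B `|` C).
Proof.
move=> [mB tcB] [mC tcC]; split => [|r e e0]; first exact: measurableU.
have e2 : 0 < e / 2 by rewrite divr_gt0.
have [s s0 sB] := tcB r _ e2; have [t t0 tC] := tcC r _ e2.
exists (Num.min s t) => [|u ust]; first by rewrite lt_min s0.
have us i : `|u 0 i| < s by have := ust i; rewrite lt_min => /andP[].
have ut i : `|u 0 i| < t by have := ust i; rewrite lt_min => /andP[].
rewrite (splitr e) EFinD; apply: le_trans (leeD (sB u us) (tC u ut)).
apply: le_trans (measureU2 _ _ _); last 2 first.
  by apply: measurableI => //; exact: measurable_leaving.
  by apply: measurableI => //; exact: measurable_leaving.
apply: le_measure; rewrite ?inE.
- by apply: measurableI => //; apply: measurable_leaving; exact: measurableU.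
- by apply: measurableU; apply: measurableI => //; exact: measurable_leaving.
move=> x [xr [[Bx|Cx] nBC]]; [left|right]; do 2 split => //=.
  by move=> Bxu; apply: nBC; left.
by move=> Cxu; apply: nBC; right.
Qed.

Lemma translation_continuous0 : translation_continuous set0.
Proof.
split => // r e e0; exists 1 => // u _.
by rewrite /leaving set0D setI0 [X in (X <= _)%E]measure0 lee_fin ltW.
Qed.

(** On a fixed cube, a finite union misses little of the countable one, and a
    point of the finite union that leaves the countable union leaves the finite
    one. *)
Lemma translation_continuous_bigcup (F : (set 'rV[R]_n)^nat) :
  (forall k, translation_continuous (F k)) ->
  translation_continuous (\bigcup_k F k).
Proof.
move=> tcF; set E := \bigcup_k F k.
have mE : measurable E by apply: bigcup_measurable => k _; exact: (tcF k).1.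
have tcn m : translation_continuous (\big[setU/set0]_(k < m) F k).
  elim/big_ind : _ => //; first exact: translation_continuous0.
  exact: translation_continuousU.
split => // r e e0; have e2 : 0 < e / 2 by rewrite divr_gt0.
pose G m := cube 0 r `&` (E `\` \big[setU/set0]_(k < m) F k).
have mG m : measurable (G m).
  by apply: measurableI => //; apply: measurableD => //; exact: (tcn m).1.
have [m Gm] : exists m, (mu (G m) <= (e / 2)%:E)%E.
  apply: exists_small_measure => //.
  - by apply: finite_cube; apply: measurableD => //; exact: (tcn 0%N).1.
  - move=> i j ij; apply/subsetPset; apply: setIS; apply: setDS.
    exact: subset_bigsetU.
  - rewrite -subset0 => x capx; have [_ [[k _ Fkx] _]] := capx 0%N I.
    have [_ [_]] := capx k.+1 I; apply; rewrite -bigcup_mkord.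
    by exists k => //=.
have [s s0 sF] := (tcn m).2 r _ e2; exists s => // u us.
rewrite (splitr e) EFinD; apply: le_trans (leeD Gm (sF u us)).
apply: le_trans (measureU2 _ _ _); last 2 first.
  exact: mG.
  by apply: measurableI => //; apply: measurable_leaving; exact: (tcn m).1.
apply: le_measure; rewrite ?inE.
- by apply: measurableI => //; exact: measurable_leaving.
- apply: measurableU => //.
  by apply: measurableI => //; apply: measurable_leaving; exact: (tcn m).1.
move=> x [xr [Ex nEx]].
have [Fx|nFx] := pselect ((\big[setU/set0]_(k < m) F k) x); [right|left]; split => //.
split => //= Fxu; apply: nEx => /=; move: Fxu.
by rewrite -bigcup_mkord => -[k _ Fk]; exists k.
Qed.

(** Points leaving the half-space under a shift smaller than [1 / m.+1] lie in a
    slab that shrinks to the empty set. *)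
Lemma translation_continuous_halfspace (i : 'I_n) (a : R) :
  translation_continuous [set x | a < x 0 i].
Proof.
pose H b := [set x : 'rV[R]_n | b < x 0 i].
have mH b : measurable (H b).
  rewrite (_ : H b = (fun x : 'rV[R]_n => x 0 i) @^-1` `]b, +oo[%classic).
    rewrite -[X in measurable X]setTI; exact: measurable_rV_coord.
  by apply/seteqP; split => x /=; rewrite in_itv/= andbT.
rewrite -[X in translation_continuous X]/(H a); split => // r e e0.
pose G (m : nat) := cube 0 r `&` (H a `\` H (a + m.+1%:R^-1)).
have mG m : measurable (G m) by apply: measurableI => //; exact: measurableD.
have [m Gm] : exists m, (mu (G m) <= e%:E)%E.
  apply: exists_small_measure => //.
  - by apply: finite_cube; exact: measurableD.
  - move=> j k jk; apply/subsetPset; apply: setIS; apply: setDS => x /=.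
    by apply: le_lt_trans; rewrite lerD2l lef_pV2 ?posrE// ler_nat.
  - rewrite -subset0 => x capx; have [_ [/= ax _]] := capx 0%N I.
    have [k] := ltr_add_invr ax => kx.
    by have [_ [_]] := capx k I; apply.
exists m.+1%:R^-1; first by rewrite invr_gt0.
move=> u um; apply: le_trans Gm; apply: le_measure; rewrite ?inE//.
  by apply: measurableI => //; exact: measurable_leaving.
move=> x [xr [/= ax axu]]; split => //; split => //= amx; apply: axu.
rewrite /H/= mxE; have := um i; rewrite ltr_norml => /andP[/(ltrD amx)+ _].
by rewrite addrK.
Qed.

(** The sets satisfying the condition form a sigma-algebra that makes every
    coordinate measurable; since the coordinates generate the Borel sets, it
    contains all of them. *)
Lemma measurable_translation_continuous B :
  measurable B -> translation_continuous B.
Proof.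
move=> mB.
have tcS : sigma_algebra setT translation_continuous.
  split; first exact: translation_continuous0.
    by move=> C /translation_continuousC; rewrite setTD.
  exact: translation_continuous_bigcup.
have : measurable_fun setT (fun x : g_sigma_algebraType translation_continuous => x : 'rV[R]_n).
  apply: measurable_fun_rV => i.
  apply: (measurability _ (RGenOInfty.measurableE R)) => _ [_ [a ->] <-].
  rewrite setTI; apply: sub_sigma_algebra.
  rewrite (_ : _ @^-1` _ = [set x : 'rV[R]_n | a < x 0 i]).
    exact: translation_continuous_halfspace.
  by apply/seteqP; split => x /=; rewrite in_itv/= andbT.
move=> /(_ measurableT _ mB); rewrite setTI /measurable/= sigma_algebra_id//.
Qed.

End translation_continuity.

(** * Autocorrelation of a bounded Borel set *)

Section autocorrelation.
Variables (R : realType) (n : nat) (r : R) (B : set 'rV[R]_n).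
Hypotheses (r0 : 0 < r) (mB : measurable B) (Br : B `<=` cube 0 r).
Implicit Types u v : 'rV[R]_n.
Local Notation mu := (@rV_lebesgue R n).

(** [autocorr u] is the integral of [1_B x * 1_B (x + u)]; averaged over [sigma]
    it gives the quantity bounded from below in the main inequality. *)
Definition autocorr u : R := fine (mu (B `&` [set x | B (x + u)])).

Let mBu u : measurable [set x | B (x + u)].
Proof. exact: measurable_shift. Qed.

Lemma bounded_rV_lebesgue_fin : (mu B < +oo)%E.
Proof.
apply: (@le_lt_trans _ _ (mu (cube 0 r))).
  by apply: le_measure => //; rewrite inE//; exact: measurable_cube.
by rewrite [X in (X < _)%E]rV_lebesgue_cube ?ltry// ltW.
Qed.

Lemma autocorrE u : (autocorr u)%:E = mu (B `&` [set x | B (x + u)]).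
Proof.
rewrite fineK// ge0_fin_numE; last exact: measure_ge0.
apply: le_lt_trans bounded_rV_lebesgue_fin.
by apply: le_measure; rewrite ?inE//; exact: measurableI.
Qed.

Lemma autocorr0 : (autocorr 0)%:E = mu B.
Proof.
rewrite autocorrE; congr (mu _).
by apply/seteqP; split => x /=; rewrite addr0 => // -[].
Qed.

Lemma autocorr_ge0 u : 0 <= autocorr u.
Proof. by rewrite fine_ge0. Qed.

Lemma autocorr_le u : autocorr u <= autocorr 0.
Proof.
rewrite -lee_fin autocorr0 autocorrE; apply: le_measure; rewrite ?inE//.
exact: measurableI.
Qed.

Lemma autocorr0_le : autocorr 0 <= r ^+ n.
Proof.
rewrite -lee_fin autocorr0 -(rV_lebesgue_cube (0 : 'rV[R]_n) (ltW r0)).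
by apply: le_measure; rewrite ?inE//; exact: measurable_cube.
Qed.

Lemma autocorr_supp u i : r <= `|u 0 i| -> autocorr u = 0.
Proof.
move=> ru; rewrite /autocorr (_ : B `&` _ = set0) ?[mu set0]measure0//.
rewrite -subset0 => x [/Br/(_ i) + /Br/(_ i)]; rewrite !mxE !subr0 => xr xur.
move: ru; apply/negP; rewrite -ltNge -[u 0 i](addKr (x 0 i)).
by apply: le_lt_trans (ler_normD _ _) _; rewrite normrN (splitr r) ltrD.
Qed.

Lemma leaving_autocorr u : mu (leaving B u) = (autocorr 0 - autocorr u)%:E.
Proof.
rewrite [LHS]measureD//; last exact: bounded_rV_lebesgue_fin.
by rewrite EFinB autocorr0 autocorrE.
Qed.

Lemma entering_autocorr u :
  mu ([set x | B (x + u)] `\` B) = (autocorr 0 - autocorr u)%:E.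
Proof.
rewrite [LHS]measureD//; last first.
  by move: bounded_rV_lebesgue_fin; rewrite -(rV_lebesgueD u mB).
by rewrite setIC EFinB autocorr0 autocorrE -(rV_lebesgueD u mB).
Qed.

(** The pairs [x, x + v] and [x, x + (v + u)] differ only when the shift by [u]
    makes the second point enter or leave [B]. Hence the modulus of continuity
    is the same everywhere as at the origin. *)
Lemma autocorr_modulus u v :
  `|autocorr (v + u) - autocorr v| <= autocorr 0 - autocorr u.
Proof.
have mBB w : measurable (B `&` [set x | B (x + w)]) by exact: measurableI.
rewrite ler_distl; apply/andP; split.
  rewrite lerBlDr -lee_fin EFinD !autocorrE -leaving_autocorr.
  have mL : measurable (leaving B u) by exact: measurable_leaving.
  rewrite -(rV_lebesgueD v mL); apply: le_trans (measureU2 _ _ _) => //.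
    apply: le_measure; rewrite ?inE//.
      by apply: measurableU => //; exact: measurable_shift.
    move=> x [Bx Bxv]; have [Bxvu|nB] := pselect (B (x + (v + u))); first by left.
    by right; split => //=; rewrite -addrA.
  exact: measurable_shift.
rewrite -lee_fin EFinD !autocorrE -entering_autocorr.
have mL : measurable ([set x | B (x + u)] `\` B) by exact: measurableD.
rewrite -(rV_lebesgueD v mL); apply: le_trans (measureU2 _ _ _) => //.
  apply: le_measure; rewrite ?inE//.
    by apply: measurableU => //; exact: measurable_shift.
  move=> x [Bx Bxvu]; have [Bxv|nB] := pselect (B (x + v)); first by left.
  by right; split => //=; rewrite -addrA.
exact: measurable_shift.
Qed.

Lemma autocorr_continuous0 e : 0 < e -> exists2 s : R, 0 < s &
  forall u, (forall i, `|u 0 i| < s) -> autocorr 0 - autocorr u <= e.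
Proof.
move=> e0; have [_ /(_ r e e0)[s s0 sB]] := measurable_translation_continuous mB.
exists s => // u /sB; rewrite -lee_fin -leaving_autocorr; congr (mu _ <= _)%E.
by apply/seteqP; split => x [] // Bx nB; split => //; exact: Br.
Qed.

End autocorrelation.

(** * The Fejer kernel *)

Section fejer_kernel.
Variables (R : realType) (N : nat).
Implicit Types t : R.

(** The one-dimensional Fejer kernel with [N.+1] exponentials, written as a sum of
    squares so that its positivity is visible. *)
Definition fejer1 t : R := N.+1%:R^-1 *
  ((\sum_(j < N.+1) cos (j%:R * t)) ^+ 2 + (\sum_(j < N.+1) sin (j%:R * t)) ^+ 2).

Lemma fejer1_ge0 t : 0 <= fejer1 t.
Proof. by rewrite mulr_ge0 ?invr_ge0// addr_ge0 ?sqr_ge0. Qed.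

Lemma fejer1E t : fejer1 t = N.+1%:R^-1 *
  \sum_(p : 'I_N.+1 * 'I_N.+1) cos ((p.1%:R - p.2%:R) * t).
Proof.
rewrite /fejer1 !expr2 !big_distrlr/= -big_split/=; congr (_ * _).
under eq_bigr do rewrite -big_split/=.
rewrite pair_bigA/=; apply: eq_bigr => -[i j] _ /=.
by rewrite mulrBl cosB.
Qed.

Lemma sum_sin_diff t :
  \sum_(p : 'I_N.+1 * 'I_N.+1) sin ((p.1%:R - p.2%:R) * t) = 0.
Proof.
rewrite -(pair_bigA _ (fun i j : 'I_N.+1 => sin ((i%:R - j%:R) * t)))/=.
under eq_bigr do under eq_bigr do rewrite mulrBl sinB.
under eq_bigr do rewrite sumrB.
rewrite sumrB exchange_big/= -sumrB big1// => i _.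
by rewrite -sumrB big1// => j _; rewrite mulrC subrr.
Qed.

(** Multiplying the exponential sum by [1 - exp (i t)] telescopes it, which gives
    [(C ^+ 2 + S ^+ 2) * (1 - cos t) = 1 - cos (N.+1 * t)] for its real and
    imaginary parts [C] and [S]. The resulting pointwise bound is all that is
    used about the concentration of the kernel at the origin. *)
Lemma fejer1_tail t : fejer1 t * (1 - cos t) <= 2 / N.+1%:R.
Proof.
set C := \sum_(j < N.+1) cos (j%:R * t); set S := \sum_(j < N.+1) sin (j%:R * t).
set c := cos t; set s := sin t.
have X : C * (1 - c) + S * s = 1 - cos (N.+1%:R * t).
  have := telescope_sumr (fun j => cos (j%:R * t)) (leq0n N.+1).
  rewrite mul0r cos0 big_mkord => /(congr1 (fun x => - x)); rewrite opprB => <-.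
  rewrite -sumrN !mulr_suml -big_split/=; apply: eq_bigr => j _.
  by rewrite -natr1 mulrDl mul1r cosD -/c -/s; ring.
have Y : S * (1 - c) - C * s = - sin (N.+1%:R * t).
  have := telescope_sumr (fun j => sin (j%:R * t)) (leq0n N.+1).
  rewrite mul0r sin0 subr0 big_mkord => <-.
  rewrite -sumrN !mulr_suml -sumrB; apply: eq_bigr => j _.
  by rewrite -natr1 mulrDl mul1r sinD -/c -/s; ring.
have XY : (C ^+ 2 + S ^+ 2) * (1 - c) <= 2.
  have E : (C ^+ 2 + S ^+ 2) * ((1 - c) ^+ 2 + s ^+ 2) =
      (1 - cos (N.+1%:R * t)) ^+ 2 + sin (N.+1%:R * t) ^+ 2.
    by rewrite -X -[sin _ ^+ 2]sqrrN -Y; ring.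
  have := cos_geN1 (N.+1%:R * t).
  move: E; have := cos2Dsin2 t; rewrite -/c -/s; have := cos2Dsin2 (N.+1%:R * t); nra.
by rewrite /fejer1 -/C -/S -mulrA [leRHS]mulrC ler_wpM2l// invr_ge0.
Qed.

Lemma measurable_cosM (a : R) : measurable_fun setT (fun t => cos (a * t)).
Proof.
apply: (measurableT_comp (f := cos)); last exact: mulrl_measurable.
exact: (continuous_measurable_fun (@continuous_cos R)).
Qed.

Lemma measurable_fejer1 (a : R) : measurable_fun setT (fun t => fejer1 (a * t)).
Proof.
under eq_fun do rewrite fejer1E.
apply: measurable_funM => //; apply: measurable_sum => p.
by under eq_fun do rewrite mulrA; exact: measurable_cosM.
Qed.

Let sin_natpi (k : nat) : sin (k%:R * pi) = 0 :> R.
Proof.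
elim: k => [|k IH]; first by rewrite mul0r sin0.
by rewrite -natr1 mulrDl mul1r sinDpi IH oppr0.
Qed.

Lemma integral_cos_period (i j : nat) (L : R) : 0 < L ->
  (\int[lebesgue_measure]_(t in ball (0%R : R) (L / 2)%R)
     (cos ((i%:R - j%:R) * (2 * pi / L * t)))%:E)%E = (if i == j then L else 0)%:E.
Proof.
move=> L0; have L20 : 0 < L / 2 by rewrite divr_gt0.
have [->|ij] := eqVneq i j.
  under eq_integral do rewrite subrr mul0r cos0.
  rewrite integral_cst; last exact: measurable_ball.
  by rewrite mul1e [LHS]lebesgue_measure_ball ?ltW// mulr2n -splitr.
pose a : R := (i%:R - j%:R) * (2 * pi / L).
have a0 : a != 0.
  rewrite mulf_neq0//; first by rewrite subr_eq0 eqr_nat.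
  by rewrite mulf_neq0// ?invr_eq0 gt_eqF// mulr_gt0// pi_gt0.
rewrite ball_itv sub0r add0r; under eq_integral do rewrite mulrA -/a.
rewrite -(integral_itv_bndoo true false); last first.
  by apply/measurable_EFinP; apply: measurable_funTS; exact: measurable_cosM.
have D t : is_derive t 1 (fun t => a^-1 * sin (a * t)) (cos (a * t)).
  apply: is_derive_eq; rewrite /= ?scaler0 ?add0r.
  by rewrite /GRing.scale/= mulr1 mulrCA mulVf// mulr1.
have C t : {for t, continuous (fun t => a^-1 * sin (a * t))}.
  by apply: differentiable_continuous; apply/derivable1_diffP; exact: ex_derive.
have cC : continuous (fun t : R => cos (a * t)).
  move=> t; apply: (@continuous_comp _ _ _ (fun t : R => a * t) cos).
    exact: mulrl_continuous.
  exact: continuous_cos.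
rewrite (continuous_FTC2 (F := fun t => a^-1 * sin (a * t))).
- rewrite -EFinB; congr EFin.
  have aL : a * (L / 2) = i%:R * pi - j%:R * pi.
    by rewrite /a; field; rewrite gt_eqF.
  rewrite mulrN aL sinN sinB !sin_natpi; ring.
- by rewrite ltrNl (lt_trans _ L20)// oppr_lt0.
- by apply: continuous_subspaceT => t; exact: cC.
- split.
  + by move=> t _; exact: ex_derive.
  + by apply: cvg_at_right_filter; exact: C.
  + by apply: cvg_at_left_filter; exact: C.
- by move=> t _; rewrite derive1E derive_val.
Qed.

(** Only the diagonal terms of the double exponential sum survive integration
    over a period. *)
Lemma integral_fejer1 (L : R) : 0 < L ->
  (\int[lebesgue_measure]_(t in ball (0%R : R) (L / 2)%R) (fejer1 (2 * pi / L * t))%:E)%E = L%:E.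
Proof.
move=> L0; have mball : measurable (ball (0 : R) (L / 2)) by exact: measurable_ball.
have mc (p : 'I_N.+1 * 'I_N.+1) : measurable_fun (ball (0 : R) (L / 2))
    (fun t => cos ((p.1%:R - p.2%:R) * (2 * pi / L * t))).
  by apply: measurable_funTS; under eq_fun do rewrite mulrA; exact: measurable_cosM.
have ic (p : 'I_N.+1 * 'I_N.+1) : lebesgue_measure.-integrable (ball (0 : R) (L / 2))
    (fun t => (cos ((p.1%:R - p.2%:R) * (2 * pi / L * t)))%:E).
  apply: measurable_bounded_integrable => //.
    by rewrite [X in (X < _)%E]lebesgue_measure_ball ?ltry// divr_ge0// ltW.
    exact: (mc p).
  exists 1; split => // M M1 t _ /=; rewrite (le_trans _ (ltW M1))// ler_norml.
  by rewrite cos_geN1 cos_le1.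
under eq_integral do rewrite fejer1E EFinM -sumEFin.
rewrite integralZl//; last exact: integrable_sum.
rewrite integral_sum//.
under eq_bigr do rewrite integral_cos_period//.
rewrite sumEFin -EFinM; congr EFin.
rewrite -(pair_bigA _ (fun i j : 'I_N.+1 => if val i == val j then L else 0))/=.
under eq_bigr => i _.
  rewrite (bigD1 i)//= eqxx big1 ?addr0; last first.
    by move=> j ji; rewrite ifN// eq_sym.
  over.
by rewrite sumr_const card_ord -[L *+ _]mulr_natl mulKf// pnatr_eq0.
Qed.

Variables (n : nat) (L : R).
Hypothesis L0 : 0 < L.
Implicit Type u : 'rV[R]_n.

Definition fejer u : R := \prod_(i < n) fejer1 (2 * pi / L * u 0 i).

Definition fejer_freq (p : {ffun 'I_n -> 'I_N.+1 * 'I_N.+1}) : 'rV[R]_n :=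
  \row_i (((p i).1%:R - (p i).2%:R) / L).

Lemma fejer_ge0 u : 0 <= fejer u.
Proof. by apply: prodr_ge0 => i _; exact: fejer1_ge0. Qed.

Lemma measurable_fejer : measurable_fun setT fejer.
Proof.
apply: measurable_prod => i _.
exact: (measurableT_comp (measurable_fejer1 _) (measurable_rV_coord i)).
Qed.

Let expi (t : R) : R[i] := (cos t +i* sin t)%C.

Let expiD (s t : R) : expi (s + t) = expi s * expi t.
Proof. by rewrite /expi cosD sinD; congr (_ +i* _)%C; ring. Qed.

Let expi_sum (I : Type) (s : seq I) (F : I -> R) :
  expi (\sum_(i <- s) F i) = \prod_(i <- s) expi (F i).
Proof.
apply: (big_morph expi expiD).
by rewrite /expi cos0 sin0.
Qed.

(** The product of the one-dimensional exponential sums expands, over complex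
    numbers, into a sum over functions from coordinates to pairs of indices. The
    imaginary part cancels because each pair comes with its transpose. What
    matters below is that all the coefficients are nonnegative. *)
Lemma fejerE u : fejer u = (N.+1%:R ^+ n)^-1 *
  \sum_(p : {ffun 'I_n -> 'I_N.+1 * 'I_N.+1}) cos (2 * pi * dotrv u (fejer_freq p)).
Proof.
pose w (p : 'I_N.+1 * 'I_N.+1) : R := p.1%:R - p.2%:R.
have F1 t : ((N.+1%:R * fejer1 t)%:C)%C = \sum_(p : 'I_N.+1 * 'I_N.+1) expi (w p * t).
  rewrite fejer1E mulrA mulfV ?mul1r ?pnatr_eq0//; apply/eqP; rewrite eq_complex /=.
  by rewrite !raddf_sum/= eqxx sum_sin_diff eqxx.
have -> : fejer u = (N.+1%:R ^+ n)^-1 * \prod_(i < n) (N.+1%:R * fejer1 (2 * pi / L * u 0 i)).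
  by rewrite big_split/= prodr_const card_ord mulrA mulVf ?mul1r//.
congr (_ * _).
suff : ((\prod_(i < n) (N.+1%:R * fejer1 (2 * pi / L * u 0 i)))%:C)%C =
    \sum_(p : {ffun 'I_n -> 'I_N.+1 * 'I_N.+1}) expi (2 * pi * dotrv u (fejer_freq p)).
  by move=> /(congr1 (@complex.Re R)); rewrite raddf_sum.
rewrite rmorph_prod/=; under eq_bigr do rewrite F1.
rewrite bigA_distr_bigA/=; apply: eq_bigr => p _.
rewrite -expi_sum /dotrv mulr_sumr; congr expi; apply: eq_bigr => i _.
by rewrite mxE /w; field; rewrite gt_eqF.
Qed.

Lemma integral_fejer :
  (\int[rV_lebesgue]_(u in cube (0 : 'rV[R]_n) L) (fejer u)%:E)%E = (L ^+ n)%:E.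
Proof.
rewrite (ge0_integral_cube_prod (F := fun _ t => fejer1 (2 * pi / L * t)) (a := fun=> L)).
- by rewrite prodr_const card_ord.
- by move=> _; exact: measurable_fejer1.
- by move=> _ t; exact: fejer1_ge0.
- by move=> i; rewrite mxE; exact: integral_fejer1.
Qed.

(** In the [i]-th factor the weight is absorbed by [fejer1_tail], while the other
    factors integrate to [L]; so the mean of [1 - cos] under the kernel is
    [O(1/N)], which plays the part of a Chebyshev bound. *)
Lemma integral_fejer_tail i :
  (\int[rV_lebesgue]_(u in cube (0 : 'rV[R]_n) L)
     (fejer u * (1 - cos (2 * pi / L * u 0 i)))%:E <= (2 / N.+1%:R * L ^+ n)%:E)%E.
Proof.
pose F (j : 'I_n) t := if j == i then 2 / N.+1%:R else fejer1 (2 * pi / L * t).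
have F0 j t : 0 <= F j t.
  by rewrite /F; case: ifP => _; [rewrite divr_ge0|exact: fejer1_ge0].
have mF j : measurable_fun setT (F j).
  by rewrite /F; case: (j == i); [exact: measurable_cst|exact: measurable_fejer1].
have mcos : measurable_fun setT (fun u => 1 - cos (2 * pi / L * u 0 i)).
  apply: measurable_funB => //.
  exact: (measurableT_comp (measurable_cosM _) (measurable_rV_coord i)).
apply: (@le_trans _ _ (\int[rV_lebesgue]_(u in cube (0 : 'rV[R]_n) L)
    (\prod_(j < n) F j (u 0 j))%:E)%E).
  apply: ge0_le_integral.
  - exact: measurable_cube.
  - by move=> u _; rewrite lee_fin mulr_ge0 ?fejer_ge0// subr_ge0 cos_le1.
  - apply: measurable_funTS; apply/measurable_EFinP.
    by apply: measurable_funM => //; exact: measurable_fejer.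
  - apply: measurable_funTS; apply/measurable_EFinP; apply: measurable_prod => j _.
    exact: (measurableT_comp (mF j) (measurable_rV_coord j)).
  - move=> u _; rewrite lee_fin /fejer (bigD1 i)//= [leRHS](bigD1 i)//= {1}/F eqxx.
    rewrite mulrAC (eq_bigr (fun j => F j (u 0 j))); last first.
      by move=> j /negPf ji; rewrite /F ji.
    by rewrite ler_wpM2r ?prodr_ge0//; exact: fejer1_tail.
rewrite (ge0_integral_cube_prod (a := fun j => if j == i then 2 / N.+1%:R * L else L))//.
  rewrite lee_fin (bigD1 i)//= eqxx (eq_bigr (fun=> L)); last by move=> j /negPf ->.
  rewrite -[leLHS]mulrA; apply: ler_wpM2l; first by rewrite divr_ge0.
  rewrite prodr_const -[leLHS]exprS.
  by rewrite cardC1 card_ord prednK// (leq_ltn_trans _ (ltn_ord i)).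
move=> j; rewrite /F mxE; case: ifP => _; last exact: integral_fejer1.
rewrite integral_cst; last exact: measurable_ball.
by rewrite [X in (_ * X)%E]lebesgue_measure_ball ?divr_ge0 ?ltW// -EFinM
  -[L / 2 *+ 2]mulr_natr divfK.
Qed.
End fejer_kernel.

(** * Trigonometric polynomials and Fejer means of the autocorrelation *)

Section trigonometric_integrals.
Variables (R : realType) (n : nat) (mu : {measure set 'rV[R]_n -> \bar R}).
Variable D : set 'rV[R]_n.
Hypotheses (mD : measurable D) (Doo : (mu D < +oo)%E).
Implicit Types x xi : 'rV[R]_n.

Definition cos_int xi : R := \int[mu]_(x in D) cos (2 * pi * dotrv x xi).
Definition sin_int xi : R := \int[mu]_(x in D) sin (2 * pi * dotrv x xi).

Lemma measurable_dotrv xi : measurable_fun setT (fun x => 2 * pi * dotrv x xi).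
Proof.
apply: measurable_funM => //; apply: measurable_sum => i.
by apply: measurable_funM => //; exact: measurable_rV_coord.
Qed.

Lemma integrable_bounded1 (f : 'rV[R]_n -> R) :
  measurable_fun setT f -> (forall x, `|f x| <= 1) -> mu.-integrable D (EFin \o f).
Proof.
move=> mf f1; apply: measurable_bounded_integrable => //; first exact: measurable_funTS.
by exists 1; split => // M M1 x _ /=; rewrite (le_trans _ (ltW M1)).
Qed.

Lemma integrable_cos xi : mu.-integrable D (EFin \o (fun x => cos (2 * pi * dotrv x xi))).
Proof.
apply: integrable_bounded1 => [|x]; last by rewrite ler_norml cos_geN1 cos_le1.
apply: (measurableT_comp _ (measurable_dotrv xi)).
exact: (continuous_measurable_fun (@continuous_cos R)).
Qed.

Lemma integrable_sin xi : mu.-integrable D (EFin \o (fun x => sin (2 * pi * dotrv x xi))).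
Proof.
apply: integrable_bounded1 => [|x]; last by rewrite ler_norml sin_geN1 sin_le1.
apply: (measurableT_comp _ (measurable_dotrv xi)).
exact: (continuous_measurable_fun (@continuous_sin R)).
Qed.

(** All the integrals of trigonometric polynomials needed below, over a bounded
    Borel set as well as against [sigma], are instances of this one. *)
Lemma integral_trig (I : finType) (k : R) (a b : I -> R) (xi : I -> 'rV[R]_n) :
  (\int[mu]_(x in D) (k * \sum_p (a p * cos (2 * pi * dotrv x (xi p)) +
     b p * sin (2 * pi * dotrv x (xi p))))%:E)%E =
  (k * \sum_p (a p * cos_int (xi p) + b p * sin_int (xi p)))%:E.
Proof.
have ic p : mu.-integrable D (fun x => (a p)%:E * (cos (2 * pi * dotrv x (xi p)))%:E)%E.
  by apply: integrableZl => //; exact: integrable_cos.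
have isin p : mu.-integrable D (fun x => (b p)%:E * (sin (2 * pi * dotrv x (xi p)))%:E)%E.
  by apply: integrableZl => //; exact: integrable_sin.
under eq_integral do rewrite EFinM -sumEFin.
under eq_integral do under eq_bigr do rewrite EFinD !EFinM.
rewrite integralZl//; last by apply: integrable_sum => // p _; exact: integrableD.
rewrite integral_sum//; last by move=> p; exact: integrableD.
rewrite EFinM -sumEFin; congr (_ * _)%E; apply: eq_bigr => p _.
rewrite integralD// !integralZl//; last 2 first.
- exact: integrable_sin.
- exact: integrable_cos.
rewrite EFinD !EFinM; congr (_ * _ + _ * _)%E.
  by rewrite fineK//; apply: integrable_fin_num => //; exact: integrable_cos.
by rewrite fineK//; apply: integrable_fin_num => //; exact: integrable_sin.
Qed.

End trigonometric_integrals.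

Definition trig_poly (R : realType) (n : nat) (I : finType) (b : I -> R)
    (xi : I -> 'rV[R]_n) (v : 'rV[R]_n) : R :=
  \sum_p b p * cos (2 * pi * dotrv v (xi p)).

Lemma dotrvDl (R : realType) (n : nat) (x y z : 'rV[R]_n) :
  dotrv (x + y) z = dotrv x z + dotrv y z.
Proof. by rewrite /dotrv -big_split/=; apply: eq_bigr => i _; rewrite mxE mulrDl. Qed.

Lemma dotrvNl (R : realType) (n : nat) (x z : 'rV[R]_n) : dotrv (- x) z = - dotrv x z.
Proof. by rewrite /dotrv -sumrN; apply: eq_bigr => i _; rewrite mxE mulNr. Qed.

Section fejer_mean.
Variables (R : realType) (n : nat) (r : R) (B : set 'rV[R]_n).
Hypotheses (r0 : 0 < r) (mB : measurable B) (Br : B `<=` cube 0 r).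
Implicit Types u v x y : 'rV[R]_n.
Local Notation mu := (@rV_lebesgue R n).
Local Notation G := (autocorr B).

Let Boo : (mu B < +oo)%E.
Proof. exact: (bounded_rV_lebesgue_fin r0 mB Br). Qed.

Lemma autocorr_integral u : (G u)%:E = (\int[mu]_x (\1_B x * \1_B (x + u))%:E)%E.
Proof.
rewrite (autocorrE r0 mB Br).
have mI : measurable (B `&` [set x | B (x + u)]).
  by apply: measurableI => //; exact: measurable_shift.
transitivity (\int[mu]_x (\1_(B `&` [set x | B (x + u)]) x)%:E)%E.
  by rewrite integral_indic// setIT.
apply: eq_integral => x _; congr EFin.
by rewrite indicI; congr (_ * _).
Qed.

Lemma measurable_autocorr : measurable_fun setT G.
Proof.
apply/measurable_EFinP.
rewrite [X in measurable_fun _ X](_ : _ =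
    fun u => \int[mu]_x (\1_B x * \1_B (x + u))%:E)%E; last first.
  by apply/funext => u; rewrite /= autocorr_integral.
apply: (@measurable_fun_fubini_tonelli_F _ _ _ _ _ mu (fun p => (\1_B p.2 * \1_B (p.2 + p.1))%:E)).
  apply/measurable_EFinP; apply: measurable_funM; first exact: measurable_indic_comp.
  by apply: measurable_indic_comp => //; exact: measurable_rVD.
by move=> p; rewrite lee_fin mulr_ge0.
Qed.

Variables (N : nat) (L : R).
Hypothesis L0 : 0 < L.
Local Notation K := (@fejer R N n L).

(** Up to normalisation, the squared modulus of the Fourier transform of [B] at
    the frequency [fejer_freq L p]. *)
Definition fejer_coef (p : {ffun 'I_n -> 'I_N.+1 * 'I_N.+1}) : R :=
  (L ^+ n)^-1 * ((N.+1%:R ^+ n)^-1 *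
  (cos_int mu B (fejer_freq L p) ^+ 2 + sin_int mu B (fejer_freq L p) ^+ 2)).

Lemma fejer_coef_ge0 p : 0 <= fejer_coef p.
Proof. by rewrite !mulr_ge0 ?invr_ge0 ?exprn_ge0 ?addr_ge0 ?sqr_ge0// ltW. Qed.

Definition fejer_mean : 'rV[R]_n -> R := trig_poly fejer_coef (fejer_freq L).

(** Expanding [cos (y - x - v)] and integrating over [x] and [y] leaves
    [(C ^+ 2 + S ^+ 2) * cos v], where [C] and [S] are the cosine and sine
    integrals of [B]: this is where nonnegative coefficients come from. *)
Lemma fejer_mean_double_integral v :
  (\int[mu]_(x in B) \int[mu]_(y in B) (K (y - x - v))%:E)%E =
  (L ^+ n * fejer_mean v)%:E.
Proof.
pose th x (p : {ffun 'I_n -> 'I_N.+1 * 'I_N.+1}) := 2 * pi * dotrv x (fejer_freq L p).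
pose C p := cos_int mu B (@fejer_freq R N n L p).
pose S p := sin_int mu B (@fejer_freq R N n L p).
transitivity (\int[mu]_(x in B) ((N.+1%:R ^+ n)^-1 * \sum_p
   ((C p * cos (th v p) + S p * sin (th v p)) * cos (th x p) +
    (S p * cos (th v p) - C p * sin (th v p)) * sin (th x p)))%:E)%E.
  apply: eq_integral => x _.
  transitivity (\int[mu]_(y in B) ((N.+1%:R ^+ n)^-1 * \sum_p
    (cos (th (x + v) p) * cos (th y p) + sin (th (x + v) p) * sin (th y p)))%:E)%E.
    apply: eq_integral => y _; rewrite fejerE//; congr ((_ * _)%:E).
    apply: eq_bigr => p _; rewrite -addrA -opprD dotrvDl dotrvNl mulrDr mulrN cosB /th.
    ring.
  rewrite integral_trig//; congr ((_ * _)%:E); apply: eq_bigr => p _.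
  by rewrite /th dotrvDl mulrDr cosD sinD -/(th x p) -/(th v p) -/(C p) -/(S p); ring.
rewrite integral_trig//; congr EFin.
rewrite /fejer_mean /trig_poly mulr_sumr mulr_sumr; apply: eq_bigr => p _.
rewrite /fejer_coef -/(th v p) -/(C p) -/(S p).
have Ln : L ^+ n != 0 by rewrite expf_neq0// gt_eqF.
rewrite !mulrA mulfV// mul1r; ring.
Qed.

(** Tonelli and the substitution [y = x + v + u]. *)
Lemma fejer_mean_convolution v :
  (\int[mu]_u (K u * G (v + u))%:E)%E = (L ^+ n * fejer_mean v)%:E.
Proof.
rewrite -fejer_mean_double_integral.
pose F (p : 'rV[R]_n * 'rV[R]_n) : R := K p.1 * (\1_B p.2 * \1_B (p.2 + (v + p.1))).
have mF : measurable_fun setT (EFin \o F).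
  apply/measurable_EFinP; apply: measurable_funM.
    by apply: (measurableT_comp (measurable_fejer N L)); exact: measurable_fst.
  apply: measurable_funM; first by apply: measurable_indic_comp => //; exact: measurable_snd.
  apply: measurable_indic_comp => //; apply: measurable_rVD; first exact: measurable_snd.
  by apply: measurable_rVD => //; exact: measurable_fst.
have F0 p : (0 <= (EFin \o F) p)%E.
  by rewrite /= lee_fin /F !mulr_ge0// fejer_ge0.
have mK w : measurable_fun setT (fun y => (K (y - w))%:E).
  apply/measurable_EFinP; apply: (measurableT_comp (measurable_fejer N L)).
  exact: measurable_rVD.
transitivity (\int[mu]_u \int[mu]_x (F (u, x))%:E)%E.
  apply: eq_integral => u _; rewrite EFinM autocorr_integral -ge0_integralZl//.
  - by apply/measurable_EFinP; apply: measurable_funM;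
       apply: measurable_indic_comp => //; exact: measurable_rVD.
  - by rewrite lee_fin fejer_ge0.
rewrite (fubini_tonelli (EFin \o F))//= [RHS]integral_mkcond.
apply: eq_integral => x _; rewrite patchE /F/=; case: ifPn => xB; last first.
  rewrite integral0_eq// => u _; rewrite [\1_B x]indicE (negbTE xB).
  by rewrite mul0r mulr0.
rewrite [RHS]integral_mkcond.
rewrite -[RHS](ge0_integral_rVD (x + v)); last 2 first.
- apply/(measurable_restrictT _ mB); apply: measurable_funTS.
  by under eq_fun do rewrite -addrA -opprD; exact: mK.
- by move=> y; rewrite patchE; case: ifP => // _; rewrite lee_fin fejer_ge0.
apply: eq_integral => u _; rewrite patchE [\1_B x]indicE xB mul1r.
rewrite addrA [u + (x + v)]addrC indicE.
case: ifPn => _; last by rewrite mulr0.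
by rewrite mulr1; congr ((K _)%:E); rewrite -addrA -opprD [x + v + u]addrC addrK.
Qed.

End fejer_mean.

(** An error that is at most [e] near the origin and is controlled by the
    functions [1 - cos] away from it integrates, against the kernel, to
    [e + O(1/N)]. *)
Lemma fejer_integral_le (R : realType) (N n : nat) (L : R) (P Q : 'rV[R]_n -> R) (e k : R) :
  0 < L -> measurable_fun setT P -> measurable_fun setT Q ->
  (forall u, 0 <= P u) -> (forall u, 0 <= Q u) -> 0 <= e -> 0 <= k ->
  (forall u, cube 0 L u -> P u <= Q u + (e + k * \sum_i (1 - cos (2 * pi / L * u 0 i)))) ->
  (\int[rV_lebesgue]_(u in cube 0%R L) (fejer N L u * P u)%:E <=
   \int[rV_lebesgue]_(u in cube 0%R L) (fejer N L u * Q u)%:E +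
     (L ^+ n * (e + k * (n%:R * (2 / N.+1%:R))))%:E)%E.
Proof.
move=> L0 mP mQ P0 Q0 e0 k0 PQ; pose K := @fejer R N n L.
have mK : measurable_fun setT K := measurable_fejer N L.
have K0 u : 0 <= K u by exact: fejer_ge0.
have mc : measurable (cube (0 : 'rV[R]_n) L) by exact: measurable_cube.
pose W i (u : 'rV[R]_n) := K u * (1 - cos (2 * pi / L * u 0 i)).
have mW i : measurable_fun setT (W i).
  apply: measurable_funM => //; apply: measurable_funB => //.
  exact: (measurableT_comp (measurable_cosM _) (measurable_rV_coord i)).
have W0 i u : 0 <= W i u by rewrite mulr_ge0// subr_ge0 cos_le1.
have mEf (f : 'rV[R]_n -> R) : measurable_fun setT f -> measurable_fun (cube 0 L) (EFin \o f).
  by move=> mf; apply: measurable_funTS; exact/measurable_EFinP.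
apply: (@le_trans _ _ (\int[rV_lebesgue]_(u in cube 0%R L)
   ((K u * Q u)%:E + (e%:E * (K u)%:E + k%:E * \sum_i (W i u)%:E)))%E).
  apply: ge0_le_integral => //.
  - by move=> u _; rewrite lee_fin mulr_ge0.
  - by apply: mEf; exact: measurable_funM.
  - apply: emeasurable_funD; first by apply: mEf; exact: measurable_funM.
    apply: emeasurable_funD; apply: measurable_funeM; first exact: mEf.
    by apply: emeasurable_sum => i; exact: mEf.
  - move=> u uL; rewrite sumEFin -!EFinM -!EFinD lee_fin.
    apply: le_trans (ler_wpM2l (K0 u) (PQ u uL)) _.
    rewrite -mulr_sumr le_eqVlt; apply/orP; left; apply/eqP; ring.
rewrite ge0_integralD//; last 4 first.
- by move=> u _; rewrite lee_fin mulr_ge0.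
- by apply: mEf; exact: measurable_funM.
- move=> u _; rewrite adde_ge0// mule_ge0// ?lee_fin// sume_ge0// => i _.
  by rewrite lee_fin.
- apply: emeasurable_funD; apply: measurable_funeM; first exact: mEf.
  by apply: emeasurable_sum => i; exact: mEf.
apply: leeD => //; rewrite ge0_integralD//; last 4 first.
- by move=> u _; rewrite mule_ge0// lee_fin.
- by apply: measurable_funeM; exact: mEf.
- move=> u _; rewrite mule_ge0// ?lee_fin// sume_ge0// => i _.
  by rewrite lee_fin.
- by apply: measurable_funeM; apply: emeasurable_sum => i; exact: mEf.
rewrite ge0_integralZl//; last 2 first.
- exact: mEf.
- by move=> u _; rewrite lee_fin.
rewrite ge0_integralZl//; last 2 first.
- by apply: emeasurable_sum => i; exact: mEf.
- by move=> u _; rewrite sume_ge0// => i _; rewrite lee_fin.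
rewrite integral_fejer// mulrDr EFinD; apply: leeD; first by rewrite -EFinM mulrC.
rewrite mulrCA EFinM lee_wpmul2l//.
rewrite ge0_integral_sum//; last 2 first.
- by move=> i; exact: mEf.
- by move=> i u _; rewrite lee_fin.
apply: le_trans (lee_sum _ (fun i _ => integral_fejer_tail N L0 i)) _.
by rewrite sumEFin lee_fin sumr_const card_ord -[_ *+ n]mulr_natl [leLHS]mulrA [leLHS]mulrC.
Qed.

(** Each Fejer mean is an average of translates of the autocorrelation against a
    kernel that concentrates at the origin, provided the period is so large that
    the periodic kernel sees the support of the autocorrelation only once. *)
Lemma fejer_mean_approx (R : realType) (n : nat) (r : R) (B : set 'rV[R]_n) (e rho : R) :
  0 < r -> measurable B -> B `<=` cube 0 r -> 0 < e -> 0 < rho ->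
  exists (N : nat) (L : R), 0 < L /\ forall v : 'rV[R]_n, (forall i, `|v 0 i| < rho) ->
    `|fejer_mean B N L v - autocorr B v| <= e.
Proof.
move=> r0 mB Br e0 rho0.
(* [autocorr B (v + u)] vanishes unless every coordinate of [u] is smaller than
   [r + rho], that is, unless [u] is in the period cube. *)
pose G := autocorr B; pose L := 2 * (r + rho).
have rrho : 0 < r + rho by exact: addr_gt0.
have L0 : 0 < L by rewrite mulr_gt0.
have L2 : L / 2 = r + rho by rewrite /L; field.
have G0 u : 0 <= G u by exact: autocorr_ge0.
have GG0 u : G u <= G 0 by exact: (autocorr_le r0 mB Br).
have mG : measurable_fun setT G by exact: (measurable_autocorr r0 mB Br).
have e20 : 0 < e / 2 by rewrite divr_gt0.
have [s1 s10 s1G] := autocorr_continuous0 r0 mB Br e20.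
pose s := Num.min s1 (L / 4).
have s0 : 0 < s by rewrite lt_min s10 divr_gt0.
have sL : s < L / 2.
  by apply: (@le_lt_trans _ _ (L / 4)); [rewrite ge_min lexx orbT|move: L0; lra].
pose q := 1 - cos (2 * pi / L * s).
have piL : 0 < 2 * pi / L by rewrite divr_gt0// mulr_gt0// pi_gt0.
have ang t : 0 <= t <= L / 2 -> 2 * pi / L * t \in `[0, pi].
  move=> /andP[t0 tL]; rewrite in_itv/= mulr_ge0 ?(ltW piL)//=.
  apply: le_trans (ler_wpM2l (ltW piL) tL) _; rewrite le_eqVlt.
  by apply/orP; left; apply/eqP; field; rewrite gt_eqF.
have q0 : 0 < q.
  rewrite subr_gt0 -[ltRHS](cos0 R) ltr_cos; first exact: mulr_gt0.
    by rewrite -[X in X \in _](mulr0 (2 * pi / L)); apply: ang; rewrite lexx/= divr_ge0// ltW.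
  by apply: ang; rewrite !ltW.
have cosL t : s <= `|t| < L / 2 -> q <= 1 - cos (2 * pi / L * t).
  move=> /andP[st tL]; rewrite lerD2l lerN2 -[cos (_ * t)]cos_norm normrM (gtr0_norm piL).
  move: st; rewrite le_eqVlt => /predU1P[->//|st]; rewrite ltW// ltr_cos ?ltr_pM2l//.
    by apply: ang; rewrite !ltW.
  by apply: ang; rewrite normr_ge0 ltW.
(* Outside the cube of radius [s], the trivial bound [G 0] for the error is at
   most [k * (1 - cos (2 pi u_i / L))] for some coordinate [i]. *)
pose k := G 0 / q.
have k0 : 0 <= k by rewrite divr_ge0// ltW.
have [N Nk] : exists N : nat, k * (n%:R * (2 / N.+1%:R)) <= e / 2.
  pose c := k * (n%:R * 2).
  have c0 : 0 <= c by apply: mulr_ge0 => //; exact: mulr_ge0.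
  have c10 : 0 < c + 1 by rewrite ltr_wpDl.
  have [N] : exists N : nat, 0 + N.+1%:R^-1 < e / 2 / (c + 1).
    by have [N ?] := @ltr_add_invr R 0 _ (divr_gt0 e20 c10); exists N.
  rewrite add0r ltr_pdivlMr// => Nc; exists N; rewrite !mulrA -(mulrA k) -/c.
  apply: le_trans (ltW Nc); rewrite mulrC ler_wpM2l ?invr_ge0// lerDl//.
exists N, L; split => // v vrho.
have bnd u : cube 0 L u -> `|G (v + u) - G v| <= e / 2 + k * \sum_i (1 - cos (2 * pi / L * u 0 i)).
  rewrite cube0 => uL.
  have S0 i : 0 <= 1 - cos (2 * pi / L * u 0 i) by rewrite subr_ge0 cos_le1.
  have [us|] := pselect (forall i, `|u 0 i| < s).
    apply: le_trans (autocorr_modulus r0 mB Br u v) _.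
    rewrite -[leLHS]addr0 lerD//; last by rewrite mulr_ge0// sumr_ge0.
    by apply: s1G => i; apply: lt_le_trans (us i) _; rewrite ge_min lexx.
  move=> /existsNP[i /negP]; rewrite -leNgt => si.
  apply: (@le_trans _ _ (G 0)).
    rewrite ler_distl; move: (G0 v) (G0 (v + u)) (GG0 v) (GG0 (v + u)); lra.
  rewrite -[leLHS]add0r lerD ?(ltW e20)//.
  rewrite -[leLHS](divfK (lt0r_neq0 q0)) ler_wpM2l//.
  apply: le_trans (cosL (u 0 i) _) _; first by rewrite si uL.
  by rewrite (bigD1 i)//= lerDl sumr_ge0.
have conv : (\int[rV_lebesgue]_(u in cube 0%R L) (fejer N L u * G (v + u))%:E)%E =
    (L ^+ n * fejer_mean B N L v)%:E.
  rewrite -(fejer_mean_convolution r0 mB Br)// integral_mkcond.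
  apply: eq_integral => u _; rewrite patchE; case: ifPn => // /negP uL.
  suff [i ui] : exists i, r <= `|(v + u) 0 i|.
    by rewrite (autocorr_supp Br ui) mulr0.
  apply/not_existsP => H; apply: uL; apply/mem_set; rewrite cube0 => i /=.
  have := H i => /negP; rewrite -ltNge mxE L2 => vur.
  rewrite -[u 0 i](addKr (v 0 i)) addrC; apply: le_lt_trans (ler_normB _ _) _.
  by rewrite ltrD.
have cst : (\int[rV_lebesgue]_(u in cube (0%R : 'rV[R]_n) L) (fejer N L u * G v)%:E)%E =
    (L ^+ n * G v)%:E.
  under eq_integral do rewrite EFinM.
  rewrite ge0_integralZr//.
  - by rewrite integral_fejer.
  - exact: measurable_cube.
  - by apply: measurable_funTS; apply/measurable_EFinP; exact: measurable_fejer.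
  - by move=> u _; rewrite lee_fin fejer_ge0.
  - by rewrite lee_fin.
have mGv : measurable_fun setT (fun u => G (v + u)).
  by apply: (measurableT_comp mG); exact: measurable_rVD.
have Ln : 0 < L ^+ n by exact: exprn_gt0.
have eN : e / 2 + k * (n%:R * (2 / N.+1%:R)) <= e.
  by rewrite [leRHS]splitr lerD2l.
rewrite ler_distl; apply/andP; split.
- have := @fejer_integral_le R N n L (fun=> G v) (fun u => G (v + u)) (e / 2) k L0
    (measurable_cst _) mGv (fun=> G0 _) (fun=> G0 _) (ltW e20) k0.
  rewrite conv cst -EFinD lee_fin -mulrDr ler_pM2l// => H.
  rewrite lerBlDr; apply: le_trans (H _) _ => [u /bnd|]; last by rewrite lerD2l.
  by rewrite ler_distlC => /andP[].
- have := @fejer_integral_le R N n L (fun u => G (v + u)) (fun=> G v) (e / 2) k L0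
    mGv (measurable_cst _) (fun=> G0 _) (fun=> G0 _) (ltW e20) k0.
  rewrite conv cst -EFinD lee_fin -mulrDr ler_pM2l// => H.
  apply: le_trans (H _) _ => [u /bnd|]; last by rewrite lerD2l.
  by rewrite ler_distl => /andP[].
Qed.

(** * Symmetric probability measures with vanishing Fourier transform *)

Section symmetric_probability.
Variables (R : realType) (n : nat) (sigma : probability 'rV[R]_n R).
Hypothesis sigmaN : forall B : set 'rV[R]_n, measurable B -> sigma [set x | B (- x)] = sigma B.
Implicit Types x xi v w : 'rV[R]_n.

Let mT : measurable [set: 'rV[R]_n].
Proof. exact: measurableT. Qed.

Let sigma_fin : (sigma [set: 'rV[R]_n] < +oo)%E.
Proof. by rewrite probability_setT ltry. Qed.

Local Notation shat xi := (cos_int sigma setT xi).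

Lemma sin_int_symmetric xi : sin_int sigma setT xi = 0.
Proof.
have isin := integrable_sin mT sigma_fin xi.
have mN : measurable_fun [set: 'rV[R]_n] (fun x : 'rV[R]_n => - x) by exact: measurable_rVN.
have isinN : sigma.-integrable ((fun x : 'rV[R]_n => - x) @^-1` setT)
    ((fun x => (sin (2 * pi * dotrv x xi))%:E) \o (fun x => - x)).
  rewrite preimage_setT (_ : _ \o _ = (fun x => - (sin (2 * pi * dotrv x xi))%:E)%E).
    exact: integrableN.
  by apply/funext => x /=; rewrite dotrvNl mulrN sinN.
have E := integral_pushforward mN (measurable_int _ isin) isinN mT.
suff H : sin_int sigma setT xi = - sin_int sigma setT xi.
  by apply/eqP; rewrite -[_ == 0](mulrn_eq0 _ 2) mulr2n {1}H addNr.
rewrite {1}/sin_int /Rintegral.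
transitivity (fine (\int[pushforward sigma (fun x : 'rV[R]_n => - x)%R]_x
  (sin (2 * pi * dotrv x xi))%:E)%E).
  by congr fine; apply: eq_measure_integral => A mA _; apply/esym; exact: sigmaN.
rewrite E preimage_setT -mulN1r -RintegralZl//; congr fine; apply: eq_integral => x _ /=.
by rewrite dotrvNl mulrN sinN mulN1r.
Qed.

Lemma cos_int_fourier xi : `|shat xi| <= Normc.normc (fourier sigma xi).
Proof.
rewrite /fourier /= (_ : Rintegral _ _ _ = shat xi).
  by rewrite -sqrtr_sqr ler_sqrt ?addr_ge0 ?sqr_ge0// lerDl sqr_ge0.
by apply: eq_Rintegral => x _; rewrite cosN.
Qed.

Lemma cos_int_le1 xi : `|shat xi| <= 1.
Proof.
apply: le_trans (le_normr_Rintegral mT (integrable_cos mT sigma_fin xi)) _.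
apply: (@le_trans _ _ (\int[sigma]_(x in setT) (cst 1 x))).
  apply: le_Rintegral => //.
  - by apply: integrable_norm; exact: integrable_cos.
  - by apply: integrable_bounded1 => // x; rewrite normr1.
  - by move=> x _; rewrite ler_norml cos_geN1 cos_le1.
by rewrite Rintegral_cst// [X in fine X](probability_setT sigma) mul1r.
Qed.

(** [`|shat xi| * (1 - cos (2 * pi * dotrv w xi))] is what a shift of [sigma] by
    [w] can change at the frequency [xi]; the supremum over all frequencies will
    be the error term of the main inequality. *)
Definition oscillation (delta : R) : R :=
  sup [set y | exists xi w, (forall i, `|w 0 i| < delta) /\
                 y = `|shat xi| * (1 - cos (2 * pi * dotrv w xi))].

Lemma oscillation_ge xi w delta : (forall i, `|w 0 i| < delta) ->
  `|shat xi| * (1 - cos (2 * pi * dotrv w xi)) <= oscillation delta.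
Proof.
move=> wd; apply: ub_le_sup; last by exists xi, w.
exists 2 => _ [xi' [w' [_ ->]]]; have := cos_int_le1 xi'.
have := cos_geN1 (2 * pi * dotrv w' xi'); have := normr_ge0 (shat xi').
have := cos_le1 (2 * pi * dotrv w' xi'); nra.
Qed.

Lemma oscillation_ge0 delta : 0 < delta -> 0 <= oscillation delta.
Proof.
move=> d0; apply: le_trans (@oscillation_ge 0 0 delta _).
  by rewrite mulr_ge0// subr_ge0 cos_le1.
by move=> i; rewrite mxE normr0.
Qed.

Lemma exists_big_cube (e : R) : 0 < e ->
  exists2 rho : R, 0 < rho & (sigma (~` cube 0 rho) <= e%:E)%E.
Proof.
move=> e0.
have mF k : measurable (~` cube (0 : 'rV[R]_n) (2 * k.+1%:R)).
  by apply: measurableC; exact: measurable_cube.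
have [k ke] : exists k, (sigma (~` cube (0 : 'rV[R]_n) (2 * k.+1%:R)%R) <= e%:E)%E.
  apply: exists_small_measure => //.
  - by apply: le_lt_trans (probability_le1 _ _) _; rewrite ?ltry.
  - move=> j k jk; apply/subsetPset; apply: subsetC; rewrite !cube0 => x + i => /(_ i) /=.
    by move=> /lt_le_trans; apply; rewrite ler_pM2r// ler_pM2l// ler_nat.
  - rewrite -subset0 => x capx.
    pose S := \sum_i `|x 0 i|.
    apply: (capx (Num.Def.archi_bound S) I); rewrite cube0 => i /=.
    have -> : 2 * (Num.Def.archi_bound S).+1%:R / 2 = (Num.Def.archi_bound S).+1%:R :> R by field.
    apply: (@le_lt_trans _ _ S); first by rewrite /S (bigD1 i)//= lerDl sumr_ge0.
    have S0 : 0 <= S by exact: sumr_ge0.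
    by apply: lt_trans (archi_boundP S0) _; rewrite ltr_nat.
by exists (2 * k.+1%:R) => //; rewrite mulr_gt0.
Qed.

End symmetric_probability.

Lemma enorm_coord (R : realType) (n : nat) (xi : 'rV[R]_n) i : `|xi 0 i| <= enorm xi.
Proof.
rewrite -sqrtr_sqr /enorm ler_sqrt /dotrv.
  by rewrite (bigD1 i)//= -expr2 lerDl sumr_ge0// => j _; rewrite -expr2 sqr_ge0.
by apply: sumr_ge0 => j _; rewrite -expr2 sqr_ge0.
Qed.

(** At high frequencies the Fourier transform is small; at the remaining
    frequencies, which are bounded, a small shift hardly changes the phase. *)
Lemma oscillation_cvg0 (R : realType) (n : nat) (sigma : probability 'rV[R]_n R) :
  (forall e : R, 0 < e -> exists M : R, forall xi,
     M < enorm xi -> Normc.normc (fourier sigma xi) < e) ->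
  oscillation sigma delta @[delta --> 0^'+] --> (0 : R).
Proof.
move=> decay; apply/cvgrPdist_le => e e0.
have [M MP] := decay (e / 2) (divr_gt0 e0 (ltr0n _ 2)).
have [s s0 sP] : exists2 s : R, 0 < s & forall t, `|t| < s -> 1 - cos t <= e.
  have /cvgrPdist_le/(_ e e0) := @continuous_cos R 0.
  rewrite -nbhs_nearE => /nbhs_ballP[s /= s0 sP]; exists s => // t ts.
  apply: le_trans (ler_norm _) _; rewrite -[X in `|X - _|](cos0 R); apply: sP.
  by rewrite /ball/= sub0r normrN.
pose m : R := 2 * pi * (n%:R * (`|M| + 1)) + 1.
have pi0 : 0 <= pi :> R by exact: pi_ge0.
have M1 : 0 <= `|M| + 1 by rewrite addr_ge0.
have m0 : 0 < m by rewrite ltr_wpDl// mulr_ge0 ?mulr_ge0.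
near=> delta.
have d0 : 0 < delta by near: delta; exact: nbhs_right_gt.
have ds : delta < s / m by near: delta; apply: nbhs_right_lt; exact: divr_gt0.
rewrite sub0r normrN ger0_norm ?oscillation_ge0//.
apply: ge_sup.
  exists (`|cos_int sigma setT 0| * (1 - cos (2 * pi * dotrv (0 : 'rV[R]_n) 0))), 0, 0.
  by split => // i; rewrite mxE normr0.
move=> _ [xi [w [wd ->]]].
have c1 := cos_int_le1 sigma xi.
have cc := cos_le1 (2 * pi * dotrv w xi).
have [Mxi|xiM] := ltP M (enorm xi).
  have := le_lt_trans (cos_int_fourier sigma xi) (MP xi Mxi).
  have := cos_geN1 (2 * pi * dotrv w xi); have := normr_ge0 (cos_int sigma setT xi).
  move: cc; nra.
rewrite -[leRHS]mul1r ler_pM ?subr_ge0//; apply: sP.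
have wxi : `|dotrv w xi| <= n%:R * (delta * (`|M| + 1)).
  apply: le_trans (ler_norm_sum _ _ _) _.
  apply: (@le_trans _ _ (\sum_(i < n) (delta * (`|M| + 1)))); last first.
    by rewrite sumr_const card_ord -[_ *+ n]mulr_natl.
  apply: ler_sum => i _; rewrite normrM ler_pM// ?(ltW (wd i))//.
  apply: le_trans (enorm_coord xi i) _; apply: le_trans xiM _.
  by apply: le_trans (ler_norm _) _; rewrite lerDl.
rewrite normrM (ger0_norm (mulr_ge0 (ler0n _ 2) pi0)).
apply: le_lt_trans (ler_wpM2l (mulr_ge0 (ler0n _ 2) pi0) wxi) _.
move: ds; rewrite ltr_pdivlMr// /m mulrDr mulr1 => ds.
apply: le_lt_trans ds.
rewrite (_ : 2 * pi * (n%:R * (delta * (`|M| + 1))) =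
  delta * (2 * pi * (n%:R * (`|M| + 1)))); last by ring.
by rewrite lerDl ltW.
Unshelve. all: by end_near. Qed.

Section mean_autocorrelation.
Variables (R : realType) (n : nat) (sigma : probability 'rV[R]_n R).
Hypothesis sigmaN : forall B : set 'rV[R]_n, measurable B -> sigma [set x | B (- x)] = sigma B.
Variables (r : R) (B : set 'rV[R]_n).
Hypotheses (r0 : 0 < r) (mB : measurable B) (Br : B `<=` cube 0 r).
Local Notation G := (autocorr B).
Implicit Types v w z : 'rV[R]_n.

Let mT : measurable [set: 'rV[R]_n].
Proof. exact: measurableT. Qed.

Let sigma_fin : (sigma [set: 'rV[R]_n] < +oo)%E.
Proof. by rewrite probability_setT ltry. Qed.

Lemma integrable_probability_bounded (f : 'rV[R]_n -> R) (M : R) :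
  measurable_fun setT f -> (forall x, `|f x| <= M) -> sigma.-integrable setT (EFin \o f).
Proof.
move=> mf fM; apply: measurable_bounded_integrable => //.
exists M; split; first exact: num_real.
by move=> M' MM' x _ /=; rewrite (le_trans (fM x))// ltW.
Qed.

Variables (I : finType) (b : I -> R) (xi : I -> 'rV[R]_n).
Hypothesis b0 : forall p, 0 <= b p.
Local Notation T := (trig_poly b xi).

Lemma trig_poly0 : T 0 = \sum_p b p.
Proof.
apply: eq_bigr => p _; rewrite (_ : dotrv 0 _ = 0) ?mulr0 ?cos0 ?mulr1//.
by rewrite /dotrv big1// => i _; rewrite mxE mul0r.
Qed.

Lemma trig_poly_bounded v : `|T v| <= T 0.
Proof.
rewrite trig_poly0; apply: le_trans (ler_norm_sum _ _ _) _; apply: ler_sum => p _.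
by rewrite normrM (ger0_norm (b0 p)) ler_piMr// cos_max.
Qed.

Lemma measurable_trig_poly : measurable_fun setT T.
Proof.
apply: measurable_sum => p; apply: measurable_funM => //.
apply: (measurableT_comp _ (measurable_dotrv (xi p))).
exact: (continuous_measurable_fun (@continuous_cos R)).
Qed.

(** The sine integrals of a symmetric measure vanish, so the shift multiplies each
    coefficient by the cosine of a phase. *)
Lemma integral_trig_poly w :
  \int[sigma]_z T (z + w) =
  \sum_p b p * (cos_int sigma setT (xi p) * cos (2 * pi * dotrv w (xi p))).
Proof.
transitivity (\int[sigma]_z (1 * \sum_p
  (b p * cos (2 * pi * dotrv w (xi p)) * cos (2 * pi * dotrv z (xi p)) +
   (- (b p * sin (2 * pi * dotrv w (xi p)))) * sin (2 * pi * dotrv z (xi p)))))%R.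
  apply: eq_Rintegral => z _; rewrite mul1r; apply: eq_bigr => p _.
  by rewrite dotrvDl mulrDr cosD; ring.
rewrite /Rintegral integral_trig//= mul1r; apply: eq_bigr => p _.
by rewrite sin_int_symmetric// mulr0 addr0; ring.
Qed.

(** Termwise comparison: this is where the nonnegativity of the coefficients is
    used. *)
Lemma integral_trig_poly_shift w (delta : R) : (forall i, `|w 0 i| < delta) ->
  \int[sigma]_z T (z + w) <= \int[sigma]_z T z + oscillation sigma delta * T 0.
Proof.
move=> wd; have -> : \int[sigma]_z T z = \int[sigma]_z T (z + 0).
  by apply: eq_Rintegral => z _; rewrite addr0.
rewrite !integral_trig_poly trig_poly0 mulr_sumr -big_split/=; apply: ler_sum => p _.
rewrite (_ : dotrv 0 _ = 0); last by rewrite /dotrv big1// => i _; rewrite mxE mul0r.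
rewrite mulr0 cos0 mulr1 [oscillation _ _ * _]mulrC -mulrDr ler_wpM2l//.
rewrite -lerBlDl; apply: le_trans (oscillation_ge sigma (xi p) wd).
rewrite -[X in _ - X]mulr1 -mulrBr -opprB mulrN -mulNr ler_wpM2r ?subr_ge0 ?cos_le1//.
by rewrite -normrN ler_norm.
Qed.

End mean_autocorrelation.

(** For trigonometric polynomials with nonnegative coefficients this is
    [integral_trig_poly_shift]. It passes to the autocorrelation because
    [fejer_mean_approx] controls it on a cube carrying almost all the mass of
    [sigma], while outside of that cube everything is bounded. *)
Lemma mean_autocorr_shift (R : realType) (n : nat) (sigma : probability 'rV[R]_n R)
    (r : R) (B : set 'rV[R]_n) (w : 'rV[R]_n) (delta : R) :
  (forall B : set 'rV[R]_n, measurable B -> sigma [set x | B (- x)] = sigma B) ->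
  0 < r -> measurable B -> B `<=` cube 0 r -> (forall i, `|w 0 i| < delta) ->  0 < delta ->
  \int[sigma]_z autocorr B (z + w) <=
  \int[sigma]_z autocorr B z + oscillation sigma delta * autocorr B 0.
Proof.
move=> sigmaN r0 mB Br wd delta0; pose G := autocorr B.
have mT : measurable [set: 'rV[R]_n] by exact: measurableT.
have G0 u : 0 <= G u by exact: autocorr_ge0.
have GG0 u : G u <= G 0 by exact: (autocorr_le r0 mB Br).
have mG : measurable_fun setT G by exact: (measurable_autocorr r0 mB Br).
have eta0 := oscillation_ge0 sigma delta0; set eta := oscillation sigma delta in eta0 *.
(* The errors made below add up to at most [e * c] as soon as [e <= 1]. *)
pose c := eta + 4 + 3 * G 0.
have c0 : 0 < c by move: (G0 0); rewrite /c; lra.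
apply/ler_addgt0Pr => e' e'0; pose e := Num.min 1 (e' / c).
have e0 : 0 < e by rewrite lt_min ltr01 divr_gt0.
have e1 : e <= 1 by rewrite ge_min lexx.
have ece : e * c <= e' by rewrite -ler_pdivlMr// ge_min lexx orbT.
have [rho rho0 sigma_rho] := exists_big_cube sigma e0.
have [N [L [L0 TG]]] := fejer_mean_approx r0 mB Br e0 (ltr_pwDl rho0 (ltW delta0)).
pose b p := @fejer_coef R n B N L p; pose xi p := @fejer_freq R N n L p.
have b0 p : 0 <= b p by exact: fejer_coef_ge0.
pose T := trig_poly b xi.
have {}TG (v : 'rV[R]_n) : (forall i, `|v 0 i| < rho + delta) -> `|T v - G v| <= e := TG v.
have T0 : T 0 <= G 0 + e.
  have /TG : forall i, `|(0 : 'rV[R]_n) 0 i| < rho + delta.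
    by move=> i; rewrite mxE normr0 addr_gt0.
  by rewrite ler_distl => /andP[].
have Tb v : `|T v| <= T 0 by exact: trig_poly_bounded.
have mT' : measurable_fun setT T by exact: measurable_trig_poly.
pose X : set 'rV[R]_n := ~` cube 0 rho.
have mX : measurable X by apply: measurableC; exact: measurable_cube.
have shiftm (f : 'rV[R]_n -> R) u : measurable_fun setT f ->
    measurable_fun setT (fun z : 'rV[R]_n => f (z + u)).
  by move=> mf; apply: (measurableT_comp mf); exact: measurable_rVD.
have iG u : sigma.-integrable setT (EFin \o (fun z : 'rV[R]_n => G (z + u))).
  apply: (@integrable_probability_bounded _ _ _ _ (G 0)); first exact: shiftm.
  by move=> x; rewrite ger0_norm.
have iT u : sigma.-integrable setT (EFin \o (fun z : 'rV[R]_n => T (z + u))).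
  by apply: (@integrable_probability_bounded _ _ _ _ (T 0)) => //; exact: shiftm.
have iX (s t : R) : sigma.-integrable setT (EFin \o (fun z : 'rV[R]_n => s + t * \1_X z)).
  apply: (@integrable_probability_bounded _ _ _ _ (`|s| + `|t|)).
    by apply: measurable_funD => //; apply: measurable_funM => //; exact: measurable_indic.
  move=> x; apply: le_trans (ler_normD _ _) _; rewrite lerD2l normrM ler_piMr// indicE.
  by case: (_ \in _); rewrite ?normr1 ?normr0.
have IX (s t : R) : 0 <= t -> \int[sigma]_z (s + t * \1_X z) <= s + t * e.
  move=> t0.
  have icst : sigma.-integrable setT (EFin \o (fun _ : 'rV[R]_n => s)).
    by apply: (@integrable_probability_bounded _ _ _ _ `|s|).
  have i1 : sigma.-integrable setT (EFin \o \1_X).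
    apply: (@integrable_probability_bounded _ _ _ _ 1); first exact: measurable_indic.
    by move=> x; rewrite indicE; case: (_ \in _); rewrite ?normr1 ?normr0.
  rewrite RintegralD//; last first.
    by have := iX 0 t; under [X in EFin \o X]eq_fun do rewrite add0r.
  rewrite Rintegral_cst// [X in fine X](probability_setT sigma) mulr1 lerD2l.
  rewrite RintegralZl// ler_wpM2l//.
  by rewrite /Rintegral integral_indic// setIT -lee_fin fineK// fin_num_measure.
have cmp (P Q : 'rV[R]_n -> R) (s t : R) : sigma.-integrable setT (EFin \o P) ->
    sigma.-integrable setT (EFin \o Q) -> 0 <= t ->
    (forall z, P z <= Q z + (s + t * \1_X z)) ->
    \int[sigma]_z P z <= \int[sigma]_z Q z + (s + t * e).
  move=> iP iQ t0 PQ; apply: (@le_trans _ _ (\int[sigma]_z (Q z + (s + t * \1_X z)))).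
    apply: le_Rintegral => //.
    by have := integrableD mT iQ (iX s t); apply: eq_integrable.
  by rewrite RintegralD// lerD2l; exact: IX.
have in_rho (z : 'rV[R]_n) : z \notin X -> forall i, `|z 0 i| < rho / 2.
  by move=> /negP zX i; move: zX; rewrite inE /X/= => /contrapT; rewrite cube0; exact.
have step1 : \int[sigma]_z G (z + w) <= \int[sigma]_z T (z + w) + (e + (2 * G 0 + e) * e).
  apply: cmp => // [|z]; first by move: (G0 0); lra.
  rewrite indicE; case: (boolP (z \in X)) => [_|/in_rho zr]; rewrite /= ?mulr1 ?mulr0 ?addr0.
    by have := GG0 (z + w); have := Tb (z + w); rewrite ler_norml => /andP[]; lra.
  have /TG : forall i, `|(z + w) 0 i| < rho + delta.
    move=> i; rewrite mxE; apply: le_lt_trans (ler_normD _ _) _.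
    by apply: ltrD => //; apply: lt_trans (zr i) _; move: rho0; lra.
  by rewrite ler_distl => /andP[]; lra.
have step2 : \int[sigma]_z T z <= \int[sigma]_z G z + (e + (G 0 + e) * e).
  have E (f : 'rV[R]_n -> R) : EFin \o f = EFin \o (fun z => f (z + 0)).
    by apply/funext => z /=; rewrite addr0.
  apply: cmp => [||| z]; [by rewrite E|by rewrite E| by rewrite addr_ge0// ltW|].
  rewrite indicE; case: (boolP (z \in X)) => [_|/in_rho zr]; rewrite /= ?mulr1 ?mulr0 ?addr0.
    by have := G0 z; have := Tb z; rewrite ler_norml => /andP[]; lra.
  have /TG : forall i, `|z 0 i| < rho + delta.
    by move=> i; apply: lt_trans (zr i) _; move: rho0 delta0; lra.
  by rewrite ler_distl => /andP[]; lra.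
have step3 := integral_trig_poly_shift sigmaN xi b0 wd.
apply: (le_trans step1); apply: (le_trans (lerD step3 (lexx _))).
rewrite -/eta -/T; move: step2 (ler_wpM2l eta0 T0) ece; rewrite /c => step2 etaT ece'.
have ee : e * e <= e by rewrite ler_piMr// ltW.
rewrite -[autocorr B 0]/(G 0); move: (G0 0) ee e0 eta0 step2 etaT ece'.
lra.
Qed.

(** * Averaging over two independent small shifts *)

(** The integral of a nonnegative function is a supremum over the simple functions
    below it, so it is monotone without any measurability. This is needed for
    [Isigma], whose integrands need not be measurable. *)
Lemma ge0_le_integral_nonmeasurable d (T : measurableType d) (R : realType)
    (mu : {measure set T -> \bar R}) (f g : T -> \bar R) :
  (forall x, (0 <= f x)%E) -> (forall x, (f x <= g x)%E) ->
  (\int[mu]_x f x <= \int[mu]_x g x)%E.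
Proof.
move=> f0 fg; have g0 x : (0 <= g x)%E by exact: le_trans (f0 x) (fg x).
rewrite !ge0_integralTE//; apply: ge_ereal_sup => /= _ [h hf <-].
by apply: ereal_sup_ubound; exists h => //= x; exact: le_trans (hf x) (fg x).
Qed.

Lemma tonelli_rotate d1 d2 d3 (T1 : measurableType d1) (T2 : measurableType d2)
    (T3 : measurableType d3) (R : realType)
    (m1 : {sigma_finite_measure set T1 -> \bar R})
    (m2 : {sigma_finite_measure set T2 -> \bar R})
    (m3 : {sigma_finite_measure set T3 -> \bar R}) (f : T1 * T2 * T3 -> \bar R) :
  measurable_fun setT f -> (forall p, (0 <= f p)%E) ->
  (\int[m1]_x \int[m2]_y \int[m3]_z f (x, y, z) =
   \int[m2]_y \int[m3]_z \int[m1]_x f (x, y, z))%E.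
Proof.
move=> mf f0.
have mg := @measurable_fun_fubini_tonelli_F _ _ _ _ _ m3 f mf f0.
have g0 p : (0 <= fubini_F m3 f p)%E by exact: integral_ge0.
rewrite (fubini_tonelli (fubini_F m3 f) mg g0)/=; apply: eq_integral => y _.
apply: (@fubini_tonelli _ _ _ _ _ m1 m3 (fun q => f (q.1, y, q.2))) => //.
apply: (measurableT_comp mf); apply: measurable_fun_pair.
  by apply: measurable_fun_pair; [exact: measurable_fst|exact: measurable_cst].
exact: measurable_snd.
Qed.

Section averaging.
Variables (R : realType) (n : nat) (sigma : probability 'rV[R]_n R).
Hypothesis sigmaN : forall B : set 'rV[R]_n, measurable B -> sigma [set x | B (- x)] = sigma B.
Variables (r : R) (B : set 'rV[R]_n).
Hypotheses (r0 : 0 < r) (mB : measurable B) (Br : B `<=` cube 0 r).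
Variables (delta eps : R).
Hypotheses (delta0 : 0 < delta) (eps0 : 0 < eps).
Local Notation mu := (@rV_lebesgue R n).
Local Notation G := (autocorr B).
Local Open Scope ereal_scope.

Definition borel_Isigma (A : set 'rV[R]_n) : \bar R :=
  \int[mu]_x \int[sigma]_z (\1_A x * \1_A (x + z)%R)%:E.

Definition borel_zoom_out : set 'rV[R]_n :=
  [set x | eps%:E * mu (cube x delta) < mu (cube x delta `&` B)].
Local Notation Z := borel_zoom_out.

Lemma borel_IsigmaE A : measurable A ->
  borel_Isigma A = \int[sigma]_z \int[mu]_x (\1_A x * \1_A (x + z)%R)%:E.
Proof.
move=> mA; apply: (@fubini_tonelli _ _ _ _ _ mu sigma
  (fun p => (\1_A p.1 * \1_A (p.1 + p.2)%R)%:E)).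
  apply/measurable_EFinP; apply: measurable_funM; apply: measurable_indic_comp => //.
  exact: measurable_rVD.
by move=> p; rewrite lee_fin mulr_ge0.
Qed.

Lemma borel_Isigma_autocorr : borel_Isigma B = (\int[sigma]_z G z)%R%:E.
Proof.
rewrite borel_IsigmaE// /Rintegral.
under [in RHS]eq_integral do rewrite (autocorr_integral r0 mB Br).
rewrite fineK//; under eq_integral do rewrite -(autocorr_integral r0 mB Br).
have : sigma.-integrable setT (EFin \o G).
  apply: (@integrable_probability_bounded _ _ _ _ (G 0)).
    exact: (measurable_autocorr r0 mB Br).
  move=> x; rewrite ger0_norm; first exact: (autocorr_le r0 mB Br).
  exact: autocorr_ge0.
exact: integrable_fin_num.
Qed.

Let Q : set 'rV[R]_n := cube 0 delta.

Let mQ : measurable Q.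
Proof. exact: measurable_cube. Qed.

Lemma local_density x : mu (cube x delta `&` B) = \int[mu]_v (\1_Q v * \1_B (x + v)%R)%:E.
Proof.
transitivity (\int[mu]_v (\1_(cube x delta `&` B) v)%:E).
  by rewrite integral_indic// ?setIT//; apply: measurableI => //; exact: measurable_cube.
rewrite -(ge0_integral_rVD x) => [|| v]; last by rewrite lee_fin.
- apply: eq_integral => v _; rewrite indicI; congr (_ * _)%:E; last by rewrite addrC.
  have E : cube x delta (v + x)%R <-> Q v.
    by split => H i; have := H i; rewrite !mxE ?subr0 addrK.
  have {}E : ((v + x)%R \in cube x delta) = (v \in Q).
    by apply/idP/idP; rewrite !inE => /E.
  by rewrite !indicE E.
- apply/measurable_EFinP; apply: measurable_indic; apply: measurableI => //.
  exact: measurable_cube.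
Qed.

Lemma measurable_zoom_out : measurable Z.
Proof.
have mq : measurable_fun setT (fun x => mu (cube x delta `&` B)).
  under eq_fun do rewrite local_density.
  apply: (@measurable_fun_fubini_tonelli_F _ _ 'rV[R]_n 'rV[R]_n _ mu
    (fun p : 'rV[R]_n * 'rV[R]_n => (\1_Q p.2 * \1_B (p.1 + p.2)%R)%:E)).
    apply/measurable_EFinP; apply: measurable_funM; apply: measurable_indic_comp => //.
    exact: measurable_rVD.
  by move=> p; rewrite lee_fin mulr_ge0.
have := emeasurable_fun_o_infty measurableT mq (eps * delta ^+ n)%:E.
rewrite setTI; congr measurable; apply/seteqP; split => x /=;
  by rewrite /Z/= rV_lebesgue_cube ?ltW// -EFinM.
Qed.

Let c : \bar R := (eps * delta ^+ n)%:E.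

(** The density condition that defines the zoomed-out set, as a pointwise lower
    bound for the convolution of [B] with the indicator of a cube. *)
Lemma zoom_out_density x : c * (\1_Z x)%:E <= \int[mu]_v (\1_Q v * \1_B (x + v)%R)%:E.
Proof.
rewrite indicE; case: (boolP (x \in Z)) => [|_]; last first.
  by rewrite mule0; apply: integral_ge0 => v _; rewrite lee_fin mulr_ge0.
by rewrite inE /Z/= rV_lebesgue_cube ?(ltW delta0)// -EFinM local_density mule1 => /ltW.
Qed.

Lemma shifted_correlation u v : \int[mu]_x (\1_B (x + u) * \1_B (x + v))%R%:E = (G (v - u))%:E.
Proof.
rewrite (autocorr_integral r0 mB Br).
rewrite -[RHS](ge0_integral_rVD u); last 2 first.
- apply/measurable_EFinP; apply: measurable_funM; apply: measurable_indic_comp => //.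
  exact: measurable_rVD.
- by move=> x; rewrite lee_fin mulr_ge0.
by apply: eq_integral => x _; rewrite -addrA [(u + _)%R]addrC subrK.
Qed.

Let M : R := (\int[sigma]_z G z + oscillation sigma delta * G 0)%R.

Let M0 : (0 <= M)%R.
Proof.
rewrite addr_ge0//; first by apply: Rintegral_ge0 => z _; exact: autocorr_ge0.
by rewrite mulr_ge0 ?oscillation_ge0//; exact: autocorr_ge0.
Qed.

Let integral_Q (a : R) : (0 <= a)%R -> \int[mu]_v (\1_Q v * a)%:E = (delta ^+ n * a)%:E.
Proof.
move=> a0; under eq_integral do rewrite EFinM.
rewrite ge0_integralZr//.
- by rewrite integral_indic// setIT [X in X * _]rV_lebesgue_cube ?ltW.
- by apply/measurable_EFinP; exact: measurable_indic.
Qed.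

Let measurable_smear (A C : set 'rV[R]_n) (k : R) (v : 'rV[R]_n) : measurable A -> measurable C ->
  measurable_fun setT (fun p : 'rV[R]_n * 'rV[R]_n * 'rV[R]_n =>
    (\1_Q p.1.1 * (k * (\1_A (p.2 + p.1.1) * \1_C (p.2 + (p.1.2 + v)))))%:E)%R.
Proof.
move=> mA mC.
have m2 : measurable_fun setT (fun p : 'rV[R]_n * 'rV[R]_n * 'rV[R]_n => p.2).
  exact: measurable_snd.
have m11 : measurable_fun setT (fun p : 'rV[R]_n * 'rV[R]_n * 'rV[R]_n => p.1.1).
  by apply: (measurableT_comp measurable_fst); exact: measurable_fst.
have m12 : measurable_fun setT (fun p : 'rV[R]_n * 'rV[R]_n * 'rV[R]_n => p.1.2).
  by apply: (measurableT_comp measurable_snd); exact: measurable_fst.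
apply/measurable_EFinP; apply: measurable_funM; first exact: measurable_indic_comp.
apply: measurable_funM => //; apply: measurable_funM; apply: measurable_indic_comp => //.
  exact: measurable_rVD.
by apply: measurable_rVD => //; exact: measurable_rVD.
Qed.

(** The bound is uniform in the shift [v - u], so it survives averaging over [u]
   and [v] in [Q]. *)
Let correlation_le (u v : 'rV[R]_n) : (forall i, `|(v - u)%R 0%R i| < delta)%R ->
  \int[sigma]_z \int[mu]_x (\1_B (x + u) * \1_B (x + (z + v)))%R%:E <= M%:E.
Proof.
move=> uv; under eq_integral do rewrite shifted_correlation -addrA.
have iG w : sigma.-integrable setT (EFin \o (fun z : 'rV[R]_n => G (z + w)%R)).
  apply: (@integrable_probability_bounded _ _ _ _ (G 0)).
    apply: (measurableT_comp (measurable_autocorr r0 mB Br)).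
    exact: measurable_rVD.
  move=> x; rewrite ger0_norm; first exact: (autocorr_le r0 mB Br).
  exact: autocorr_ge0.
rewrite -[leLHS]fineK; last exact: (integrable_fin_num _ (iG (v - u)%R)).
by rewrite lee_fin; exact: (mean_autocorr_shift sigmaN r0 mB Br uv).
Qed.

(** Averaging the correlation over [u] in [Q] smears its first factor, which
   becomes at least [c] on the zoomed-out set. *)
Let zoomed_correlation_le (v : 'rV[R]_n) : Q v ->
  \int[sigma]_z \int[mu]_x (eps * delta ^+ n * (\1_Z x * \1_B (x + (z + v))))%R%:E
    <= (delta ^+ n * M)%:E.
Proof.
rewrite /Q cube0 => Qv; rewrite -(integral_Q M0).
have k0 : (0 <= eps * delta ^+ n)%R.
  by apply: mulr_ge0; [exact: ltW|apply: exprn_ge0; exact: ltW].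
pose f (p : 'rV[R]_n * 'rV[R]_n * 'rV[R]_n) : \bar R :=
  (\1_Q p.1.1 * (1 * (\1_B (p.2 + p.1.1) * \1_B (p.2 + (p.1.2 + v)))))%R%:E.
have mf : measurable_fun setT f by exact: measurable_smear.
have f0 p : 0 <= f p by rewrite lee_fin !mulr_ge0.
apply: (@le_trans _ _ (\int[mu]_u \int[sigma]_z \int[mu]_x f (u, z, x))).
  rewrite (@tonelli_rotate _ _ _ _ _ _ _ mu sigma mu f)//.
  apply: ge0_le_integral_nonmeasurable => z.
    by apply: integral_ge0 => x _; rewrite lee_fin; apply: mulr_ge0 => //; exact: mulr_ge0.
  apply: ge0_le_integral_nonmeasurable => x.
    by rewrite lee_fin; apply: mulr_ge0 => //; exact: mulr_ge0.
  rewrite /f/= mulrA EFinM.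
  under eq_integral do rewrite mul1r mulrA EFinM.
  rewrite ge0_integralZr//.
  - by apply: lee_wpmul2r; [rewrite lee_fin|rewrite EFinM; exact: zoom_out_density].
  - by apply/measurable_EFinP; apply: measurable_funM;
       apply: measurable_indic_comp => //; exact: measurable_rVD.
apply: ge0_le_integral_nonmeasurable => u.
  by apply: integral_ge0 => z _; exact: integral_ge0.
rewrite /f/= [(\1_Q u)]indicE; case: (boolP (u \in Q)) => [|_]; last first.
  rewrite mul0r integral0_eq// => z _; rewrite integral0_eq// => x _.
  by rewrite mul0r.
rewrite inE /Q cube0 => Qu.
under eq_integral do under eq_integral do rewrite !mul1r.
rewrite mul1r; apply: correlation_le => i; rewrite !mxE.
apply: le_lt_trans (ler_normB _ _) _; rewrite (splitr delta); exact: ltrD.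
Qed.

(** Averaging over [v] in [Q] smears the second factor as well; the two volumes of
    [Q] cancel and a factor [eps] is gained for each of the two points. *)
Lemma zoom_out_correlation :
  (eps ^+ 2)%:E * borel_Isigma Z <= borel_Isigma B + (oscillation sigma delta * r ^+ n)%:E.
Proof.
have mZ := measurable_zoom_out.
apply: (@le_trans _ _ M%:E); last first.
  rewrite borel_Isigma_autocorr -EFinD lee_fin lerD2l ler_wpM2l ?oscillation_ge0//.
  exact: (autocorr0_le r0 mB Br).
have D0 : (0 < delta ^+ n)%R by exact: exprn_gt0.
have D20 : (0 < (delta ^+ n) ^+ 2)%R by exact: exprn_gt0.
rewrite -(@lee_pmul2l _ ((delta ^+ n) ^+ 2)%:E)//.
rewrite muleA -EFinM -exprMn -[X in _ <= X]EFinM.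
rewrite [((delta ^+ n) ^+ 2 * M)%R](_ : _ = delta ^+ n * (delta ^+ n * M))%R; last by rewrite mulrA.
rewrite -(integral_Q (mulr_ge0 (ltW D0) M0)).
pose k := (eps * delta ^+ n)%R.
have k0 : (0 <= k)%R by apply: mulr_ge0; exact: ltW.
pose f (p : 'rV[R]_n * 'rV[R]_n * 'rV[R]_n) : \bar R :=
  (\1_Q p.1.1 * (k * (\1_Z p.2 * \1_B (p.2 + (p.1.2 + p.1.1)))))%R%:E.
have f0 p : 0 <= f p.
  by rewrite lee_fin; apply: mulr_ge0 => //; apply: mulr_ge0 => //; exact: mulr_ge0.
have kZ x : 0 <= (k * \1_Z x)%:E by rewrite lee_fin; exact: mulr_ge0.
have mf : measurable_fun setT f.
  have m2 : measurable_fun setT (fun p : 'rV[R]_n * 'rV[R]_n * 'rV[R]_n => p.2).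
    exact: measurable_snd.
  have m11 : measurable_fun setT (fun p : 'rV[R]_n * 'rV[R]_n * 'rV[R]_n => p.1.1).
    by apply: (measurableT_comp measurable_fst); exact: measurable_fst.
  have m12 : measurable_fun setT (fun p : 'rV[R]_n * 'rV[R]_n * 'rV[R]_n => p.1.2).
    by apply: (measurableT_comp measurable_snd); exact: measurable_fst.
  apply/measurable_EFinP; apply: measurable_funM; first exact: measurable_indic_comp.
  apply: measurable_funM => //; apply: measurable_funM; apply: measurable_indic_comp => //.
  by apply: measurable_rVD => //; exact: measurable_rVD.
apply: (@le_trans _ _ (\int[mu]_v \int[sigma]_z \int[mu]_x f (v, z, x))); last first.
  apply: ge0_le_integral_nonmeasurable => v.
    by apply: integral_ge0 => z _; exact: integral_ge0.
  rewrite /f/= [(\1_Q v)]indicE; case: (boolP (v \in Q)) => [|_]; last first.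
    rewrite mul0r integral0_eq// => z _; rewrite integral0_eq// => x _.
    by rewrite mul0r.
  rewrite inE => Qv; rewrite mul1r.
  under eq_integral do under eq_integral do rewrite mul1r.
  exact: zoomed_correlation_le.
rewrite (@tonelli_rotate _ _ _ _ _ _ _ mu sigma mu f)// borel_IsigmaE//.
have mg (z : 'rV[R]_n) : measurable_fun setT
    (fun x : 'rV[R]_n => (\1_Z x * \1_Z (x + z))%R%:E : \bar R).
  apply/measurable_EFinP; apply: measurable_funM; first exact: measurable_indic.
  by apply: (measurable_indic_comp (f := fun x : 'rV[R]_n => x + z)%R mZ); exact: measurable_rVD.
have k20 : 0 <= ((delta ^+ n * eps) ^+ 2)%R%:E by rewrite lee_fin sqr_ge0.
rewrite -ge0_integralZl//; last 2 first.
- apply: (@measurable_fun_fubini_tonelli_G _ _ _ _ _ mu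
    (fun p : 'rV[R]_n * 'rV[R]_n => (\1_Z p.1 * \1_Z (p.1 + p.2))%R%:E)).
    apply/measurable_EFinP; apply: measurable_funM; apply: measurable_indic_comp => //.
    exact: measurable_rVD.
  by move=> p; rewrite lee_fin mulr_ge0.
- by move=> z _; apply: integral_ge0 => x _; rewrite lee_fin mulr_ge0.
apply: ge0_le_integral_nonmeasurable => z.
  by rewrite mule_ge0// integral_ge0// => x _; rewrite lee_fin mulr_ge0.
rewrite -ge0_integralZl//.
apply: ge0_le_integral_nonmeasurable => x.
  by rewrite mule_ge0// lee_fin mulr_ge0.
rewrite /f/=.
have -> : ((delta ^+ n * eps) ^+ 2)%R%:E * (\1_Z x * \1_Z (x + z))%R%:E =
    (k * \1_Z x)%:E * (c * (\1_Z (x + z)%R)%:E).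
  by rewrite /c /k -!EFinM; congr EFin; ring.
apply: (@le_trans _ _ ((k * \1_Z x)%:E * \int[mu]_v (\1_Q v * \1_B (x + z + v)%R)%:E)).
  by apply: lee_wpmul2l => //; exact: zoom_out_density.
rewrite -ge0_integralZl//; last first.
  by apply/measurable_EFinP; apply: measurable_funM;
       apply: measurable_indic_comp => //; exact: measurable_rVD.
rewrite le_eqVlt; apply/orP; left; apply/eqP; apply: eq_integral => v _.
by rewrite -EFinM; congr EFin; rewrite addrA; ring.
Qed.

End averaging.

(** * From Borel sets to Lebesgue measurable sets *)

Section completion.
Variables (R : realType) (n : nat).
Local Notation mu := (@rV_lebesgue R n).
Local Notation cmu := (@completed_rV_lebesgue R n).
Local Open Scope ereal_scope.

Lemma completed_rV_lebesgueE (A : set 'rV[R]_n) : measurable A -> cmu A = mu A.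
Proof. exact: measurable_mu_extE. Qed.

Lemma borel_lebesgue_measurable (A : set 'rV[R]_n) : measurable A -> lebesgue_measurable A.
Proof. exact: caratheodory_measurable_mu_ext. Qed.

(** The Borel measure is the image of the completed one under the identity. *)
Lemma integral_completed (f : 'rV[R]_n -> \bar R) :
  measurable_fun setT f -> (forall x, 0 <= f x) ->
  \int[cmu]_x f x = \int[mu]_x f x.
Proof.
move=> mf f0.
pose T := caratheodory_type ((mu)^*)%mu.
have mid : @measurable_fun _ _ T 'rV[R]_n setT (fun x : T => x : 'rV[R]_n).
  by move=> _ Y mY; rewrite setTI; exact: borel_lebesgue_measurable.
have := ge0_integral_pushforward mid cmu measurableT mf (fun x _ => f0 x).
rewrite preimage_setT => /esym E; apply: (etrans E).
by apply: eq_measure_integral => A mA _; exact: completed_rV_lebesgueE.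
Qed.

(** Intersecting coverings whose total measures approach the outer measure. *)
Lemma outer_hull (X : set 'rV[R]_n) : cmu X < +oo ->
  exists C, [/\ measurable C, X `<=` C & mu C <= cmu X].
Proof.
move=> Xoo.
have Xfin : cmu X \is a fin_num by rewrite ge0_fin_numE.
have H (k : nat) : exists C, [/\ measurable C, X `<=` C & mu C <= cmu X + k.+1%:R^-1%:E].
  have k0 : (0 < k.+1%:R^-1 :> R)%R by rewrite invr_gt0.
  have [_ [F [mF XF] <-] Fk] := @lb_ereal_inf_adherent _ _ _ k0 Xfin.
  exists (\bigcup_i F i); split => //; first exact: bigcupT_measurable.
  by apply: le_trans (ltW Fk); apply: measure_sigma_subadditive => //; exact: bigcupT_measurable.
have /choice[C CP] := H.
exists (\bigcap_k C k); split.
- by apply: bigcapT_measurable => k; have [] := CP k.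
- by move=> x Xx k _; have [_ + _] := CP k; apply.
- apply/lee_addgt0Pr => e e0.
  have [k] := ltr_add_invr e0; rewrite add0r => ke.
  have [mC _ CX] := CP k.
  apply: (@le_trans _ _ (mu (C k))).
    apply: le_measure; rewrite ?inE//; last exact: bigcap_inf.
    by apply: bigcapT_measurable => j; have [] := CP j.
  by apply: le_trans CX _; rewrite leeD2l// lee_fin ltW.
Qed.

(** The complement, in the cube, of a measurable hull of the complement of [A]. *)
Lemma inner_kernel (A : set 'rV[R]_n) (r : R) : (0 <= r)%R ->
  lebesgue_measurable A -> A `<=` cube 0%R r ->
  exists B, [/\ measurable B, B `<=` A & cmu (A `\` B) = 0].
Proof.
move=> r0 mA Ar; pose Q := cube (0%R : 'rV[R]_n) r.
have mQ : measurable Q by exact: measurable_cube.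
have mQ' : lebesgue_measurable Q by exact: borel_lebesgue_measurable.
have Qoo : cmu Q < +oo by rewrite completed_rV_lebesgueE// [X in X < _]rV_lebesgue_cube ?ltry.
have mQA : lebesgue_measurable (Q `\` A) by exact: measurableD.
have QAoo : cmu (Q `\` A) < +oo.
  by apply: le_lt_trans Qoo; apply: le_measure; rewrite ?inE.
have [C [mC QAC CQA]] := outer_hull QAoo.
have mB : measurable (Q `\` C) by exact: measurableD.
exists (Q `\` C); split => //.
  by move=> x [Qx nCx]; apply: contrapT => nAx; apply: nCx; exact: QAC.
have mC' : lebesgue_measurable C by exact: borel_lebesgue_measurable.
have -> : A `\` (Q `\` C) = (C `\` (Q `\` A)) `&` Q.
  apply/seteqP; split => x /=.
    move=> [Ax nQC]; split; last exact: Ar.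
    split; last by move=> [_]; apply.
    by apply: contrapT => nC; apply: nQC; split => //; exact: Ar.
  by move=> [[Cx nQA] Qx]; split; [apply: contrapT => nA; apply: nQA|move=> [_]; apply].
apply/eqP; rewrite eq_le measure_ge0 andbT.
have mD : lebesgue_measurable (C `\` (Q `\` A)) by exact: measurableD.
apply: (@le_trans _ _ (cmu (C `\` (Q `\` A)))).
  by apply: le_measure; rewrite ?inE//; exact: measurableI.
have cCE := completed_rV_lebesgueE mC.
have Coo : cmu C < +oo by rewrite cCE; apply: le_lt_trans QAoo.
rewrite [leLHS]measureD//; have -> : C `&` (Q `\` A) = Q `\` A by exact: setIidr.
apply: (@le_trans _ _ (cmu C - cmu (Q `\` A))) => //.
by rewrite sube_le0 cCE.
Qed.

Variable sigma : probability 'rV[R]_n R.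

Let correlation_meas (A : set 'rV[R]_n) : measurable A ->
  measurable_fun setT (fun x : 'rV[R]_n => \int[sigma]_z ((\1_A x * \1_A (x + z))%R%:E : \bar R)).
Proof.
move=> mA; apply: (@measurable_fun_fubini_tonelli_F _ _ 'rV[R]_n 'rV[R]_n _ sigma
  (fun p : 'rV[R]_n * 'rV[R]_n => (\1_A p.1 * \1_A (p.1 + p.2))%R%:E)).
  apply/measurable_EFinP; apply: measurable_funM.
    exact: measurable_indic_comp.
  by apply: measurable_indic_comp => //; exact: measurable_rVD.
by move=> p; rewrite lee_fin mulr_ge0.
Qed.

Lemma Isigma_borel (A : set 'rV[R]_n) : measurable A ->
  Isigma sigma A = borel_Isigma sigma A.
Proof.
move=> mA; apply: (integral_completed (correlation_meas mA)) => x.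
by apply: integral_ge0 => z _; rewrite lee_fin mulr_ge0.
Qed.

Lemma le_Isigma (A B : set 'rV[R]_n) : B `<=` A -> Isigma sigma B <= Isigma sigma A.
Proof.
move=> BA; have le_ind x : (\1_B x <= \1_A x :> R)%R.
  rewrite !indicE ler_nat; case: (boolP (x \in B)) => //; rewrite inE => /BA Ax.
  by rewrite mem_set.
apply: ge0_le_integral_nonmeasurable => x.
  by apply: integral_ge0 => z _; rewrite lee_fin mulr_ge0.
apply: ge0_le_integral_nonmeasurable => z; first by rewrite lee_fin mulr_ge0.
by rewrite lee_fin ler_pM.
Qed.

(** Removing a null set from [A] changes none of its local densities. *)
Lemma zoom_out_borel (A B : set 'rV[R]_n) (delta eps : R) : lebesgue_measurable A ->
  measurable B -> B `<=` A -> cmu (A `\` B) = 0 ->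
  zoom_out delta eps A = borel_zoom_out B delta eps.
Proof.
move=> mA mB BA AB0.
have E x : cmu (cube x delta `&` A) = mu (cube x delta `&` B).
  have mc : measurable (cube x delta) by exact: measurable_cube.
  have mc' : lebesgue_measurable (cube x delta) by exact: borel_lebesgue_measurable.
  have mB' : lebesgue_measurable B by exact: borel_lebesgue_measurable.
  rewrite -completed_rV_lebesgueE; last exact: measurableI.
  have mcA : lebesgue_measurable (cube x delta `&` A) by exact: measurableI.
  have mcB : lebesgue_measurable (cube x delta `&` B) by exact: measurableI.
  have mAB : lebesgue_measurable (A `\` B) by exact: measurableD.
  apply/eqP; rewrite eq_le; apply/andP; split.
    rewrite -[leRHS]adde0 -AB0; apply: le_trans (measureU2 _ _ _) => //.
    apply: le_measure; rewrite ?inE//; first exact: measurableU.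
    move=> y [cy Ay]; have [By|nBy] := pselect (B y); [by left|by right].
  by apply: le_measure; rewrite ?inE//; exact: setIS.
apply/seteqP; split => x; rewrite /zoom_out/borel_zoom_out/= E completed_rV_lebesgueE//;
  exact: measurable_cube.
Qed.

End completion.

(** * The supersaturation inequality *)

Theorem corollary16 (R : realType) (d : nat) (hd : (2 <= d)%N)
    (sigma : probability 'rV[R]_d R) (hsigma : admissible sigma) :
  exists (g : R -> R) (h : R -> R -> R),
    [/\ forall eps : R, 0 < eps -> 0 < g eps,
        forall eps : R, 0 < eps -> h eps delta @[delta --> 0^'+] --> (0 : R)
      & forall (r eps delta : R), 0 < r -> 0 < eps -> 0 < delta ->
          forall A : set 'rV[R]_d, lebesgue_measurable A -> A `<=` cube 0 r ->
            ((g eps)%:E * Isigma sigma (zoom_out delta eps A)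
               - (h eps delta * r ^+ d)%:E <= Isigma sigma A)%E].
Proof.
have [sigmaN _ _ decay] := hsigma.
exists (fun eps => eps ^+ 2), (fun _ => oscillation sigma); split.
- by move=> eps; exact: exprn_gt0.
- by move=> eps _; exact: oscillation_cvg0.
move=> r eps delta r0 eps0 delta0 A mA Ar.
have [B [mB BA AB0]] := inner_kernel (ltW r0) mA Ar.
have Br : B `<=` cube 0 r by exact: subset_trans Ar.
rewrite (zoom_out_borel _ _ mA mB BA AB0) leeBlDr//.
rewrite Isigma_borel; last exact: measurable_zoom_out.
apply: le_trans (zoom_out_correlation sigmaN r0 mB Br delta0 eps0) _.
by rewrite leeD2r// -Isigma_borel//; exact: le_Isigma.
Qed.
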